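(* Let $(M^{n},g,T)$, $n>3$, be a compact connected Riemannian spin manifold with a non-trivial 3-form $T$ and $\nabla^{c}T=0$, where $\nabla^{c}=\nabla^{g}+\frac12T$. Let $s=\frac{n-1}{4(n-3)}$ (so $s\neq0,1/4$) and let $\varphi_{0}\in\mathcal{K}^{s}(M^{n},g)_{\zeta}$ be a $\nabla^{c}$-parallel Killing spinor with torsion with Killing number $\zeta=\frac{3\gamma(1-4s)}{4n}$ for some $0\neq\gamma\in\mathrm{Spec}(T)$. Set $\lambda:=\frac{1}{2(n-3)}$. Then $\varphi_{0}$ satisfies the following condition as an identity, for every vector field $X$: $$\mathrm{Ric}^{c}(X)\cdot\varphi_{0}=-16s\zeta(X\lrcorner T)\cdot\varphi_{0}+4(n-1)\zeta^{2}X\cdot\varphi_{0}+(1-12\lambda^{2})(X\lrcorner\sigma_{T})\cdot\varphi_{0}-2(2\lambda^{2}+\lambda)\sum_{i}T(X,e_{i})\cdot(e_{i}\lrcorner T)\cdot\varphi_{0}.$$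
   Context: $\nabla^{g}$ is the Levi-Civita connection; $\nabla^{s}=\nabla^{g}+2sT$, i.e. $g(\nabla^{s}_{X}Y,Z)=g(\nabla^{g}_{X}Y,Z)+2s\,T(X,Y,Z)$; $\nabla^c=\nabla^{1/4}$. $\Sigma$ is the spinor bundle, ''$\cdot$'' is Clifford multiplication with $X\cdot Y+Y\cdot X=-2g(X,Y)$; forms act by Clifford multiplication; on $\Sigma$, $\nabla^{s}_{X}\varphi=\nabla^{g}_{X}\varphi+s(X\lrcorner T)\cdot\varphi$. $\mathcal{K}^{s}(M,g)_{\zeta}=\{\varphi\in\Gamma(\Sigma):\nabla^{s}_{X}\varphi=\zeta X\cdot\varphi\ \forall X\}$. $\mathrm{Spec}(T)$ is the set of eigenvalues of $T$ acting on $\Sigma$. $T(X,Y)$ is the vector with $g(T(X,Y),Z)=T(X,Y,Z)$; $\{e_{i}\}$ is a local orthonormal frame; $\sigma_{T}=\frac12\sum_{i}(e_{i}\lrcorner T)\wedge(e_{i}\lrcorner T)$; $\mathrm{Ric}^{c}$ is the Ricci endomorphism of $\nabla^{c}$, $\mathrm{Ric}^{c}(X,Y)=\sum_iR^c(X,e_i,e_i,Y)$. *)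

(* Defs.v *)
From HB Require Import structures.
From mathcomp Require Import all_boot all_order all_algebra.
From mathcomp Require Import all_classical all_reals all_analysis.
From mathcomp Require Import complex.
Import Order.TTheory GRing.Theory Num.Theory.
Import numFieldNormedType.Exports.

Set Implicit Arguments.
Unset Strict Implicit.
Unset Printing Implicit Defensive.

Local Open Scope classical_set_scope.
Local Open Scope complex_scope.
Local Open Scope ring_scope.

(* [U] is always an open subset of R^n below. *)
Fixpoint Ck (R : realType) (n k : nat) (U : set 'rV[R]_n) (f : 'rV[R]_n -> R)
    : Prop :=
  (forall x, U x -> f @ x --> f x) /\
  match k with
  | 0%N => True
  | k'.+1 => forall i : 'I_n,
      (forall x, U x -> derivable f x (delta_mx 0 i)) /\
      Ck k' U (fun x => 'D_(delta_mx 0 i) f x)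
  end.

Definition smooth (R : realType) (n : nat) (U : set 'rV[R]_n)
  (f : 'rV[R]_n -> R) : Prop := forall k, Ck k U f.

(* [param i] is the inverse of the chart [chart i : dom i -> R^n], and
   [chart_at p] is a preferred chart around [p]. *)
Record smooth_atlas (R : realType) (n : nat) (M : topologicalType) := SmoothAtlas {
  chart_index : Type;
  dom : chart_index -> set M;
  chart : chart_index -> M -> 'rV[R]_n;
  param : chart_index -> 'rV[R]_n -> M;
  chart_at : M -> chart_index;
  dom_open : forall i, open (dom i);
  image_open : forall i, open (chart i @` dom i);
  paramK : forall i p, dom i p -> param i (chart i p) = p;
  chart_continuous : forall i p, dom i p -> chart i @ p --> chart i p;
  param_continuous : forall i x, (chart i @` dom i) x -> param i @ x --> param i x;
  chart_atP : forall p, dom (chart_at p) p;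
  transition_smooth : forall i j k,
    smooth (chart i @` (dom i `&` dom j)) (fun x => chart j (param i x) 0 k)
}.

Definition smooth_fun (R : realType) (n : nat) (M : topologicalType)
  (A : smooth_atlas R n M) (V : set M) (f : M -> R) : Prop :=
  forall i : chart_index A, smooth (chart i @` (dom i `&` V)) (f \o param i).

(* The tangent space at [p] is R^n, a vector being identified with its
   components in the preferred chart [chart_at p]; [dd A p v f] is the derivative
   of [f] at [p] along [v]. In particular, the components of [v] in another chart
   [chart i] around [p] are those of [dd A p v (chart i)]. *)
Definition dd (R : realType) (n : nat) (M : topologicalType)
  (A : smooth_atlas R n M) (W : normedModType R)
  (p : M) (v : 'rV[R]_n) (f : M -> W) : W :=
  'D_v (f \o param (chart_at A p)) (chart (chart_at A p) p).

Definition smooth_vf (R : realType) (n : nat) (M : topologicalType)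
  (A : smooth_atlas R n M) (V : set M) (X : M -> 'rV[R]_n) : Prop :=
  forall (i : chart_index A) (k : 'I_n),
    smooth_fun A (V `&` dom i) (fun p => dd A p (X p) (chart i) 0 k).

(* [X, Y]^k = X(Y^k) - Y(X^k) in the chart [chart_at p]. *)
Definition lie (R : realType) (n : nat) (M : topologicalType)
  (A : smooth_atlas R n M) (X Y : M -> 'rV[R]_n) (p : M) : 'rV[R]_n :=
  dd A p (X p) (fun q => dd A q (Y q) (chart (chart_at A p)))
  - dd A p (Y p) (fun q => dd A q (X q) (chart (chart_at A p))).

Definition ip (R : realType) (n : nat) (M : Type) (g : M -> 'M[R]_n)
  (p : M) (u v : 'rV[R]_n) : R := (u *m g p *m v^T) 0 0.

Definition is_metric (R : realType) (n : nat) (M : topologicalType)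
  (A : smooth_atlas R n M) (g : M -> 'M[R]_n) : Prop :=
  [/\ forall p, (g p)^T = g p,
      forall p v, v != 0 -> 0 < ip g p v v
    & forall V X Y, open V -> smooth_vf A V X -> smooth_vf A V Y ->
        smooth_fun A V (fun p => ip g p (X p) (Y p))].

Definition orthonormal_frame (R : realType) (n : nat) (M : topologicalType)
  (A : smooth_atlas R n M) (g : M -> 'M[R]_n) (V : set M)
  (e : 'I_n -> M -> 'rV[R]_n) : Prop :=
  (forall i, smooth_vf A V (e i)) /\
  (forall p i j, V p -> ip g p (e i p) (e j p) = (i == j)%:R).

Definition is_3form (R : realType) (n : nat) (M : topologicalType)
  (A : smooth_atlas R n M)
  (T : M -> 'rV[R]_n -> 'rV[R]_n -> 'rV[R]_n -> R) : Prop :=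
  [/\ forall p a u u' v w, T p (a *: u + u') v w = a * T p u v w + T p u' v w,
      forall p u v w, T p v u w = - T p u v w,
      forall p u v w, T p u w v = - T p u v w
    & forall V X Y Z, open V -> smooth_vf A V X -> smooth_vf A V Y ->
        smooth_vf A V Z -> smooth_fun A V (fun p => T p (X p) (Y p) (Z p))].

(* The vector T(u, v): it is characterised by g(T(u, v), w) = T(u, v, w). *)
Definition Tvec (R : realType) (n : nat) (M : Type) (g : M -> 'M[R]_n)
  (T : M -> 'rV[R]_n -> 'rV[R]_n -> 'rV[R]_n -> R) (p : M) (u v : 'rV[R]_n)
  : 'rV[R]_n :=
  (\row_j T p u v (delta_mx 0 j)) *m invmx (g p).

(* [nab p v Y] is the covariant derivative at [p] of the vector field [Y] along
   the tangent vector [v]; it is only constrained for [Y] smooth near [p]. *)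
Definition is_connection (R : realType) (n : nat) (M : topologicalType)
  (A : smooth_atlas R n M)
  (nab : M -> 'rV[R]_n -> (M -> 'rV[R]_n) -> 'rV[R]_n) : Prop :=
  forall V Y, open V -> smooth_vf A V Y ->
  [/\ forall p a u v, V p -> nab p (a *: u + v) Y = a *: nab p u Y + nab p v Y,
      forall p v Z, V p -> smooth_vf A V Z ->
        nab p v (fun q => Y q + Z q) = nab p v Y + nab p v Z,
      forall p v f, V p -> smooth_fun A V f ->
        nab p v (fun q => f q *: Y q) = dd A p v f *: Y p + f p *: nab p v Y
    & forall X, smooth_vf A V X -> smooth_vf A V (fun p => nab p (X p) Y)].

Definition is_levi_civita (R : realType) (n : nat) (M : topologicalType)
  (A : smooth_atlas R n M) (g : M -> 'M[R]_n)
  (nab : M -> 'rV[R]_n -> (M -> 'rV[R]_n) -> 'rV[R]_n) : Prop :=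
  is_connection A nab /\
  forall V X Y p, open V -> smooth_vf A V X -> smooth_vf A V Y -> V p ->
    nab p (X p) Y - nab p (Y p) X = lie A X Y p /\
    forall v, dd A p v (fun q => ip g q (X q) (Y q)) =
              ip g p (nab p v X) (Y p) + ip g p (X p) (nab p v Y).

Definition conn (R : realType) (n : nat) (M : Type) (g : M -> 'M[R]_n)
  (T : M -> 'rV[R]_n -> 'rV[R]_n -> 'rV[R]_n -> R)
  (nab : M -> 'rV[R]_n -> (M -> 'rV[R]_n) -> 'rV[R]_n) (s : R)
  (p : M) (v : 'rV[R]_n) (Y : M -> 'rV[R]_n) : 'rV[R]_n :=
  nab p v Y + (2 * s) *: Tvec g T p v (Y p).

Definition parallel_3form (R : realType) (n : nat) (M : topologicalType)
  (A : smooth_atlas R n M)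
  (nab : M -> 'rV[R]_n -> (M -> 'rV[R]_n) -> 'rV[R]_n)
  (T : M -> 'rV[R]_n -> 'rV[R]_n -> 'rV[R]_n -> R) : Prop :=
  forall V X Y Z p v, open V -> smooth_vf A V X -> smooth_vf A V Y ->
    smooth_vf A V Z -> V p ->
    dd A p v (fun q => T q (X q) (Y q) (Z q))
    - T p (nab p v X) (Y p) (Z p) - T p (X p) (nab p v Y) (Z p)
    - T p (X p) (Y p) (nab p v Z) = 0.

Definition curv (R : realType) (n : nat) (M : topologicalType)
  (A : smooth_atlas R n M)
  (nab : M -> 'rV[R]_n -> (M -> 'rV[R]_n) -> 'rV[R]_n)
  (X Y Z : M -> 'rV[R]_n) (p : M) : 'rV[R]_n :=
  nab p (X p) (fun q => nab q (Y q) Z) - nab p (Y p) (fun q => nab q (X q) Z)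
  - nab p (lie A X Y p) Z.

(* The vector Ric(X) with g(Ric(X), Y) = sum_i R(X, e_i, e_i, Y), where
   R(X, Y, Z, V) = g(R(X, Y) Z, V). *)
Definition ric (R : realType) (n : nat) (M : topologicalType)
  (A : smooth_atlas R n M)
  (nab : M -> 'rV[R]_n -> (M -> 'rV[R]_n) -> 'rV[R]_n)
  (e : 'I_n -> M -> 'rV[R]_n) (X : M -> 'rV[R]_n) (p : M) : 'rV[R]_n :=
  \sum_(i < n) curv A nab X (e i) (e i) p.

Definition wedge22 (R : realType) (n : nat) (a b : 'rV[R]_n -> 'rV[R]_n -> R)
  (u v w z : 'rV[R]_n) : R :=
  a u v * b w z - a u w * b v z + a u z * b v w
  + a v w * b u z - a v z * b u w + a w z * b u v.

Definition sigmaT (R : realType) (n : nat) (M : Type)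
  (e : 'I_n -> M -> 'rV[R]_n)
  (T : M -> 'rV[R]_n -> 'rV[R]_n -> 'rV[R]_n -> R)
  (p : M) (u v w z : 'rV[R]_n) : R :=
  2^-1 * \sum_(i < n) wedge22 (T p (e i p)) (T p (e i p)) u v w z.

Definition spdim (n : nat) : nat := (2 ^ n./2)%N.

(* A complex representation of Cl_n of dimension 2^[n/2]; it is automatically
   irreducible, i.e. it is a space of Dirac spinors. *)
Definition clifford (R : realType) (n : nat)
  (gam : 'I_n -> 'M[R[i]]_(spdim n)) : Prop :=
  forall i j, gam i *m gam j + gam j *m gam i = (- ((i == j)%:R *+ 2))%:M.

Definition cmul (R : realType) (n : nat) (gam : 'I_n -> 'M[R[i]]_(spdim n))
  (x : 'rV[R]_n) : 'M[R[i]]_(spdim n) := \sum_(i < n) (x 0 i)%:C *: gam i.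

(* The group Spin(n) of products of an even number of unit vectors of R^n.
   The representation of the even Clifford algebra is faithful in every
   dimension, so that Spin(n) can be viewed inside the group of matrices. *)
Definition is_spin (R : realType) (n : nat) (gam : 'I_n -> 'M[R[i]]_(spdim n))
  (h : 'M[R[i]]_(spdim n)) : Prop :=
  exists xs : seq 'rV[R]_n,
    [/\ ~~ odd (size xs), all (fun x : 'rV[R]_n => \sum_(i < n) x 0 i ^+ 2 == 1) xs
      & h = foldr (fun x B => cmul gam x *m B) 1%:M xs].

Definition csmooth_fun (R : realType) (n : nat) (M : topologicalType)
  (A : smooth_atlas R n M) (V : set M) (f : M -> R[i]) : Prop :=
  smooth_fun A V (fun p => complex.Re (f p)) /\
  smooth_fun A V (fun p => complex.Im (f p)).

(* A spin structure given by local sections s_a of the principal Spin(n)-bundle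
   over an open cover: [frame a] is the orthonormal frame under s_a, and
   s_b = s_a [trans a b]. By [trans_frame], the change of frame from [frame a] to
   [frame b] is the image of [trans a b] under Spin(n) -> SO(n); in particular
   the frames are compatible with an orientation. *)
Record spin_structure (R : realType) (n : nat) (M : topologicalType)
    (A : smooth_atlas R n M) (g : M -> 'M[R]_n)
    (gam : 'I_n -> 'M[R[i]]_(spdim n)) := SpinStructure {
  triv : Type;
  tdom : triv -> set M;
  frame : triv -> 'I_n -> M -> 'rV[R]_n;
  trans : triv -> triv -> M -> 'M[R[i]]_(spdim n);
  tdom_open : forall a, open (tdom a);
  tdom_cover : forall p, exists a, tdom a p;
  frame_orthonormal : forall a, orthonormal_frame A g (tdom a) (frame a);
  trans_smooth : forall a b k l,
    csmooth_fun A (tdom a `&` tdom b) (fun p => trans a b p k l);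
  trans_spin : forall a b p, tdom a p -> tdom b p -> is_spin gam (trans a b p);
  trans_cocycle : forall a b c p, tdom a p -> tdom b p -> tdom c p ->
    trans a b p *m trans b c p = trans a c p;
  trans_frame : forall a b p j, tdom a p -> tdom b p ->
    cmul gam (\row_i ip g p (frame b j p) (frame a i p)) *m trans a b p
    = trans a b p *m gam j
}.

(* A section of the associated bundle, as the family of its expressions in the
   local trivialisations. *)
Definition spinor_field (R : realType) (n : nat) (M : topologicalType)
  (A : smooth_atlas R n M) (g : M -> 'M[R]_n)
  (gam : 'I_n -> 'M[R[i]]_(spdim n)) (S : spin_structure A g gam)
  (phi : triv S -> M -> 'cV[R[i]]_(spdim n)) : Prop :=
  (forall a k, csmooth_fun A (tdom a) (fun p => phi a p k 0)) /\
  (forall a b p, tdom a p -> tdom b p -> phi a p = trans a b p *m phi b p).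

(* Clifford multiplication by vectors, 2-forms and 3-forms on the fibre of the
   spinor bundle at [p], in the trivialisation [a]. *)
Definition cl1 (R : realType) (n : nat) (M : topologicalType)
  (A : smooth_atlas R n M) (g : M -> 'M[R]_n)
  (gam : 'I_n -> 'M[R[i]]_(spdim n)) (S : spin_structure A g gam)
  (a : triv S) (p : M) (v : 'rV[R]_n) : 'M[R[i]]_(spdim n) :=
  cmul gam (\row_i ip g p v (frame a i p)).

Definition cl2 (R : realType) (n : nat) (M : topologicalType)
  (A : smooth_atlas R n M) (g : M -> 'M[R]_n)
  (gam : 'I_n -> 'M[R[i]]_(spdim n)) (S : spin_structure A g gam)
  (a : triv S) (p : M) (w : 'rV[R]_n -> 'rV[R]_n -> R) : 'M[R[i]]_(spdim n) :=
  \sum_(i < n) \sum_(j < n | (i < j)%N)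
    (w (frame a i p) (frame a j p))%:C *: (gam i *m gam j).

Definition cl3 (R : realType) (n : nat) (M : topologicalType)
  (A : smooth_atlas R n M) (g : M -> 'M[R]_n)
  (gam : 'I_n -> 'M[R[i]]_(spdim n)) (S : spin_structure A g gam)
  (a : triv S) (p : M) (w : 'rV[R]_n -> 'rV[R]_n -> 'rV[R]_n -> R)
  : 'M[R[i]]_(spdim n) :=
  \sum_(i < n) \sum_(j < n | (i < j)%N) \sum_(k < n | (j < k)%N)
    (w (frame a i p) (frame a j p) (frame a k p))%:C
    *: (gam i *m gam j *m gam k).

(* When T is parallel and M connected, the eigenvalues of T on the fibre at [p] do
   not depend on [p]. *)
Definition Spec (R : realType) (n : nat) (M : topologicalType)
  (A : smooth_atlas R n M) (g : M -> 'M[R]_n)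
  (gam : 'I_n -> 'M[R[i]]_(spdim n)) (S : spin_structure A g gam)
  (T : M -> 'rV[R]_n -> 'rV[R]_n -> 'rV[R]_n -> R) : set R[i] :=
  [set c | exists (a : triv S) (p : M) (psi : 'cV[R[i]]_(spdim n)),
     [/\ tdom a p, psi != 0 & cl3 a p (T p) *m psi = c *: psi]].

Definition cdd (R : realType) (n N : nat) (M : topologicalType)
  (A : smooth_atlas R n M) (p : M) (v : 'rV[R]_n) (f : M -> 'cV[R[i]]_N)
  : 'cV[R[i]]_N :=
  \col_k (dd A p v (fun q => complex.Re (f q k 0))
          +i* dd A p v (fun q => complex.Im (f q k 0))).

(* The connection induced by the Levi-Civita connection [nab]:
   v(phi) + 1/2 sum_(k < l) g(nabla_v e_k, e_l) e_k . e_l . phi. *)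
Definition spin_lc (R : realType) (n : nat) (M : topologicalType)
  (A : smooth_atlas R n M) (g : M -> 'M[R]_n)
  (nab : M -> 'rV[R]_n -> (M -> 'rV[R]_n) -> 'rV[R]_n)
  (gam : 'I_n -> 'M[R[i]]_(spdim n)) (S : spin_structure A g gam)
  (a : triv S) (p : M) (v : 'rV[R]_n)
  (phi : triv S -> M -> 'cV[R[i]]_(spdim n)) : 'cV[R[i]]_(spdim n) :=
  cdd A p v (phi a)
  + 2^-1 *: (\sum_(k < n) \sum_(l < n | (k < l)%N)
       (ip g p (nab p v (frame a k)) (frame a l p))%:C
       *: (gam k *m gam l *m phi a p)).

Definition spin_conn (R : realType) (n : nat) (M : topologicalType)
  (A : smooth_atlas R n M) (g : M -> 'M[R]_n)
  (T : M -> 'rV[R]_n -> 'rV[R]_n -> 'rV[R]_n -> R)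
  (nab : M -> 'rV[R]_n -> (M -> 'rV[R]_n) -> 'rV[R]_n)
  (gam : 'I_n -> 'M[R[i]]_(spdim n)) (S : spin_structure A g gam) (s : R)
  (a : triv S) (p : M) (v : 'rV[R]_n)
  (phi : triv S -> M -> 'cV[R[i]]_(spdim n)) : 'cV[R[i]]_(spdim n) :=
  spin_lc nab a p v phi + s%:C *: (cl2 a p (T p v) *m phi a p).

Definition killing (R : realType) (n : nat) (M : topologicalType)
  (A : smooth_atlas R n M) (g : M -> 'M[R]_n)
  (T : M -> 'rV[R]_n -> 'rV[R]_n -> 'rV[R]_n -> R)
  (nab : M -> 'rV[R]_n -> (M -> 'rV[R]_n) -> 'rV[R]_n)
  (gam : 'I_n -> 'M[R[i]]_(spdim n)) (S : spin_structure A g gam)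
  (s : R) (zeta : R[i]) : set (triv S -> M -> 'cV[R[i]]_(spdim n)) :=
  [set phi | spinor_field phi /\
     forall (a : triv S) p v, tdom a p ->
       spin_conn T nab s a p v phi = zeta *: (cl1 a p v *m phi a p)].

Definition parallel_spinor (R : realType) (n : nat) (M : topologicalType)
  (A : smooth_atlas R n M) (g : M -> 'M[R]_n)
  (T : M -> 'rV[R]_n -> 'rV[R]_n -> 'rV[R]_n -> R)
  (nab : M -> 'rV[R]_n -> (M -> 'rV[R]_n) -> 'rV[R]_n)
  (gam : 'I_n -> 'M[R[i]]_(spdim n)) (S : spin_structure A g gam) (s : R)
  (phi : triv S -> M -> 'cV[R[i]]_(spdim n)) : Prop :=
  forall (a : triv S) p v, tdom a p -> spin_conn T nab s a p v phi = 0.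

(* Main.v *)
Require Import Defs.
From HB Require Import structures.
From mathcomp Require Import all_boot all_order all_algebra.
From mathcomp Require Import all_classical all_reals all_analysis.
From mathcomp Require Import complex.
From mathcomp Require Import ring lra zify.
Import Order.TTheory GRing.Theory Num.Theory.
Import numFieldNormedType.Exports.

(** Put [mu := zeta / lambda]. Subtracting the two equations satisfied by the
    spinor [phi] gives [(X _| T) phi = mu X phi] for all [X]. The Clifford identity
    [[T, X _| T] = 2 X _| sigma_T] and [T phi = - (n mu / 3) phi] then yield
    [(X _| sigma_T) phi = (n - 3) / 3 mu^2 X phi], and likewise
    [sum_i T(X, e_i) (e_i _| T) phi = - 2 mu^2 X phi].

    On the other hand, a parallel spinor is annihilated by the curvature
    2-forms of [nabla^c]. As [T] is parallel and skew-symmetric, the first Bianchi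
    identity has the 4-form [sigma_T] as its right-hand side, so the curvature
    is symmetric in pairs, and contracting with the Clifford multiplication gives
    [Ric^c(X) phi = (X _| sigma_T) phi]. Hence both sides of the statement are
    multiples of [X phi], and the coefficients agree for the given [s] and
    [lambda]. *)

(** Two obstacles shape the proof. A tangent vector is recorded in a preferred chart that may change
    abruptly with the point, so the raw components of a smooth field need not be smooth. Regularity
    and brackets are therefore read off from derivatives of functions in one fixed chart, and the
    geometry is then carried out in an abstract calculus on an open set, governed by the Leibniz,
    Jacobi, metric and torsion rules. Moreover, spinors are expressed in the frame of the spin
    structure, while [ric] and [sigmaT] use an arbitrary orthonormal frame. Sums over increasing
    indices do not pass term by term from one frame to the other, so 2-forms and 3-forms are handled
    through sums over all indices, which are 2 and 6 times their Clifford action; this is the origin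
    of most factors 2 and 6 below. *)

Set Implicit Arguments.
Unset Strict Implicit.

Local Open Scope classical_set_scope.
Local Open Scope complex_scope.
Local Open Scope ring_scope.

(** * Calculus on open subsets of R^n *)

Section Calculus.
Context {R : realType} {n : nat}.
Implicit Types (f g : 'rV[R]_n -> R) (U : set 'rV[R]_n) (x v : 'rV[R]_n).

(** The mean value theorem for the real function [h]. Bounding [t] by absolute values treats both
    signs of [a] at once, since the coordinates of an increment have no fixed sign. *)
Lemma MVT_line f x v (a : R) :
  (forall t, `|t| <= `|a| -> derivable f (t *: v + x) v) ->
  exists2 t, `|t| <= `|a| & f (a *: v + x) - f x = a * 'D_v f (t *: v + x).
Proof.
move=> df; pose h (t : R) := f (t *: v + x); pose dh (t : R) : R := 'D_v f (t *: v + x).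
have dhP (t : R) : `|t| <= `|a| -> is_derive t (1 : R) h (dh t).
  move=> ta.
  have E : (fun s => s^-1 *: ((h \o shift t) (s *: 1) - h t)) =
           (fun s => s^-1 *: ((f \o shift (t *: v + x)) (s *: v) - f (t *: v + x))).
    apply/funext => s; rewrite /h /=; congr (_ *: (f _ - _)).
    by rewrite addrA -scalerDl scaler1.
  have dt := df _ ta; split; first by rewrite /derivable E.
  by rewrite /derive E.
have hc (t : R) : `|t| <= `|a| -> {for t, continuous h}.
  move=> /dhP dt; apply: differentiable_continuous.
  by apply/derivable1_diffP; apply: ex_derive.
have [a0|/ltW a0] := leP 0 a.
  have [||c] := @MVT_segment R h dh 0 a a0.
  - move=> t; rewrite in_itv /= => /andP[t0 ta]; apply: dhP.
    by rewrite !ger0_norm//; apply: ltW.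
  - apply/continuous_in_subspaceT => t; rewrite inE /= in_itv /= => /andP[t0 ta].
    by apply: hc; rewrite !ger0_norm.
  rewrite in_itv /= => /andP[c0 ca] E; exists c; first by rewrite !ger0_norm.
  by move: E; rewrite /h scale0r add0r subr0 mulrC.
have [||c] := @MVT_segment R h dh a 0 a0.
- move=> t; rewrite in_itv /= => /andP[ta t0]; apply: dhP.
  by rewrite !ler0_norm// ?lerN2; apply: ltW.
- apply/continuous_in_subspaceT => t; rewrite inE /= in_itv /= => /andP[ta t0].
  by apply: hc; rewrite !ler0_norm// lerN2.
rewrite in_itv /= => /andP[ca c0] E; exists c; first by rewrite !ler0_norm// lerN2.
move: E; rewrite /h scale0r add0r sub0r mulrN => /(congr1 -%R).
by rewrite opprB opprK mulrC.
Qed.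

Lemma ex_linear_form (c : 'I_n -> R) :
  exists2 L : {linear 'rV[R]_n -> R}, continuous L &
    L = (fun h => \sum_i h 0 i * c i) :> ('rV[R]_n -> R).
Proof.
pose df (h : 'rV[R]_n) : R := \sum_i h 0 i * c i.
have lin_df : linear df.
  move=> a u v; rewrite /df scaler_sumr -big_split /=; apply: eq_bigr => i _.
  by rewrite !mxE mulrDl scalerAl.
pose linM := GRing.isLinear.Build _ _ _ _ _ lin_df.
pose Ldf : {linear _ -> _} := HB.pack df linM.
exists Ldf => //.
apply: (@continuous_big R 'I_n +%R 0 xpredT (@add_continuous R) 'rV[R]_n
  (index_enum 'I_n) (fun i h => h 0 i * c i)) => i _ y.
have cy : h 0 i @[h --> y] --> y 0 i := @coord_continuous R 1 n 0 i y.
exact: (cvgM cy (cvg_cst _)).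
Qed.

Lemma rV_norm_coord x j : `|x 0 j| <= `|x|.
Proof.
rewrite [leRHS]/Num.norm /= mx_normrE.
exact: (le_bigmax _ (fun i => `|x i.1 i.2|) (0, j)).
Qed.

Lemma rV_norm_le x (c : R) : 0 <= c -> (forall j, `|x 0 j| <= c) -> `|x| <= c.
Proof.
move=> c0 xc; rewrite [leLHS]/Num.norm /= mx_normrE.
by apply/bigmax_leP; split => // -[i j] _ /=; rewrite ord1.
Qed.

(** [Ck] speaks of partial derivatives only. The total derivative is recovered by going from [x] to
    [x + h] one coordinate at a time, with the mean value theorem on each move. *)
Lemma C1_differentiable U f x : open U -> U x -> Ck 1 U f ->
  differentiable f x.
Proof.
move=> Uo Ux [_ dU].
have dU1 i y : U y -> derivable f y (delta_mx 0 i) by move=> ?; apply (dU i).1.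
have dU2 i : 'D_(delta_mx 0 i) f @ x --> 'D_(delta_mx 0 i) f x.
  by have [_ [dc _]] := dU i; exact: dc.
have [df dfc dfE] := ex_linear_form (fun i => 'D_(delta_mx 0 i) f x).
suff E : f \o shift x = cst (f x) + (df : _ -> R) +o_ (0 : 'rV[R]_n) id.
  by apply/diff_locallyP; rewrite (diff_unique dfc E).
(* The [n] moves each get the share [e / n.+1] of the error, a quotient that makes sense even for
   [n = 0]. *)
apply/eqaddoP => e e0; have e0n : 0 < (e / n.+1%:R) by rewrite divr_gt0.
pose Q y := U y /\ forall i,
  `|'D_(delta_mx 0 i) f x - 'D_(delta_mx 0 i) f y| < e / n.+1%:R.
have /nbhs_ballP[r /= r0 rQ] : nbhs x Q.
  apply: filterI; first exact: open_nbhs_nbhs.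
  apply: (@filter_forall _ _
    (fun i y => `|'D_(delta_mx 0 i) f x - 'D_(delta_mx 0 i) f y| < e / n.+1%:R)
    _ (nbhs_filter x)) => i.
  by have /cvgrPdist_lt := dU2 i; apply.
near=> h; have hr : `|h| < r.
  near: h; apply/nbhs_ballP; exists r => //= y.
  by rewrite -ball_normE /= sub0r normrN.
(* [hk k] keeps the first [k] coordinates of [h]: the corners of a path of axis-parallel moves from
   0 to [h] on which the sup norm never exceeds that of [h]. *)
pose hk k : 'rV[R]_n := \row_j (if (j < k)%N then h 0 j else 0).
have h0 : hk 0%N = 0 by apply/rowP => j; rewrite !mxE.
have hn : hk n = h by apply/rowP => j; rewrite !mxE ltn_ord.
have hS (k : 'I_n) : hk k.+1 = h 0 k *: delta_mx 0 k + hk k.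
  apply/rowP => j; rewrite !mxE eqxx /= ltnS leq_eqVlt -val_eqE /=.
  by case: ltngtP; rewrite ?(mulr0, mulr1, add0r, addr0)// => /val_inj ->.
have step (k : 'I_n) : `|f (hk k.+1 + x) - f (hk k + x)
    - h 0 k * 'D_(delta_mx 0 k) f x| <= e / n.+1%:R * `|h|.
  have hkh j : `|h 0 j| <= `|h|.
    exact: rV_norm_coord.
  have inQ t : `|t| <= `|h 0 k| -> Q (t *: delta_mx 0 k + (hk k + x)).
    move=> tk; apply: rQ; rewrite -ball_normE /= distrC addrA addrK.
    apply: le_lt_trans hr; apply: rV_norm_le => // j.
    rewrite !mxE eqxx /= eq_sym -val_eqE /=.
    case: ltngtP => jk; rewrite ?(mulr0, mulr1, add0r, addr0, normr0)//.
    exact: le_trans tk (hkh _).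
  have [t tk] := @MVT_line f (hk k + x) (delta_mx 0 k) (h 0 k)
    (fun t tk => dU1 k _ (inQ t tk).1).
  rewrite addrA -hS => ->; rewrite -mulrBr normrM mulrC.
  by rewrite ler_pM// ltW// distrC; apply (inQ t tk).2.
have -> : (f \o shift x - (cst (f x) + df)) h =
   \sum_(k < n) (f (hk k.+1 + x) - f (hk k + x) - h 0 k * 'D_(delta_mx 0 k) f x).
  rewrite sumrB -(big_mkord xpredT (fun k => f (hk k.+1 + x) - f (hk k + x))).
  by rewrite telescope_sumr// hn h0 add0r /= /cst dfE opprD addrA.
apply: le_trans (ler_norm_sum _ _ _) _.
apply: (@le_trans _ _ (\sum_(k < n) e / n.+1%:R * `|h|)).
  by apply: ler_sum => k _; exact: step.
rewrite -mulr_suml ler_wpM2r ?normr_ge0// sumr_const card_ord -[_ *+ n]mulr_natl.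
rewrite mulrCA ger_pMr// ler_pdivrMr ?ltr0n// mul1r ler_nat.
by [].
Unshelve. all: by end_near. Qed.

Lemma derive_coordE f x v : differentiable f x ->
  'D_v f x = \sum_i v 0 i * 'D_(delta_mx 0 i) f x.
Proof.
move=> df; rewrite deriveE// {1}(row_sum_delta v) linear_sum.
by apply: eq_bigr => i _; rewrite linearZ /= deriveE.
Qed.

Lemma near_in_open (W : Type) U (f g : 'rV[R]_n -> W) x : open U -> U x ->
  {in U, f =1 g} -> \forall y \near nbhs x, f y = g y.
Proof.
move=> Uo Ux fg; have Un : nbhs x U by exact: open_nbhs_nbhs.
by apply: (@filterS _ _ (nbhs_filter x) _ _ _ Un) => y Uy; rewrite fg ?inE.
Qed.

Lemma cvg_congr U f g x (l : R) : open U -> U x -> {in U, f =1 g} ->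
  f @ x --> l -> g @ x --> l.
Proof.
move=> Uo Ux fg; apply: cvg_trans.
apply: (@near_eq_cvg _ _ (nbhs x) (nbhs_filter x)); exact: near_in_open fg.
Qed.

Lemma derivable_congr U f g x v : open U -> U x -> {in U, f =1 g} ->
  derivable f x v -> derivable g x v.
Proof.
by move=> Uo Ux fg; apply: near_eq_derivable; exact: near_in_open fg.
Qed.

Lemma derive_congr (W : normedModType R) U (f g : 'rV[R]_n -> W) x v :
  open U -> U x -> {in U, f =1 g} -> 'D_v f x = 'D_v g x.
Proof.
by move=> Uo Ux fg; apply: near_eq_derive; exact: near_in_open fg.
Qed.

Lemma Ck_congr k U f g : open U -> {in U, f =1 g} -> Ck k U f -> Ck k U g.
Proof.
move=> Uo; elim: k f g => [|k IH] f g fg [fc dU];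
    have gc x : U x -> g @ x --> g x.
- by move=> Ux; rewrite -fg ?inE//; exact: cvg_congr fg (fc x Ux).
- by split.
- by move=> Ux; rewrite -fg ?inE//; exact: cvg_congr fg (fc x Ux).
split=> // i; have [df cf] := dU i; split=> [x Ux|].
  exact: (derivable_congr Uo Ux fg (df x Ux)).
apply: IH cf => x; rewrite inE => Ux; exact: (derive_congr _ Uo Ux fg).
Qed.

Lemma Ck_sub k U U' f : U' `<=` U -> Ck k U f -> Ck k U' f.
Proof.
move=> UU'; elim: k f => [|k IH] f [fc dU]; first by split=> // x /UU' /fc.
split=> [x /UU' /fc//|i]; have [df cf] := dU i.
by split=> [x /UU' /df//|]; exact: IH.
Qed.

Lemma CkW k U f : Ck k.+1 U f -> Ck k U f.
Proof.
elim: k f => [|k IH] f [fc dU]; first by split.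
by split=> // i; have [df cf] := dU i; split=> //; exact: IH.
Qed.

Lemma Ck_cst k U (c : R) : Ck k U (cst c).
Proof.
have cc (d : R) (x : 'rV[R]_n) : (cst d : _ -> R) @ x --> d by exact: cst_continuous.
elim: k c => [|k IH] c; split=> // i.
split=> [x _|]; first exact: derivable_cst.
suff -> : (fun x => 'D_(delta_mx 0 i) (cst c) x) = cst 0 by exact: IH.
by apply/funext => x; rewrite derive_cst.
Qed.

Lemma CkD k U f g : open U -> Ck k U f -> Ck k U g -> Ck k U (f \+ g).
Proof.
move=> Uo; elim: k f g => [|k IH] f g [fc df] [gc dg].
  by split=> // x Ux; exact: (cvgD (fc x Ux) (gc x Ux)).
split=> [x Ux|i]; first by exact: (cvgD (fc x Ux) (gc x Ux)).
have [df1 df2] := df i; have [dg1 dg2] := dg i.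
split=> [x Ux|]; first by exact: (derivableD (df1 x Ux) (dg1 x Ux)).
apply: Ck_congr (IH _ _ df2 dg2) => // x; rewrite inE => Ux /=.
by rewrite (deriveD (df1 x Ux) (dg1 x Ux)).
Qed.

Lemma CkM k U f g : open U -> Ck k U f -> Ck k U g -> Ck k U (f \* g).
Proof.
move=> Uo; elim: k f g => [|k IH] f g cf cg; have [fc df] := cf; have [gc dg] := cg.
  by split=> // x Ux; exact: (cvgM (fc x Ux) (gc x Ux)).
split=> [x Ux|i]; first by exact: (cvgM (fc x Ux) (gc x Ux)).
have [df1 df2] := df i; have [dg1 dg2] := dg i.
split=> [x Ux|]; first by exact: (derivableM (df1 x Ux) (dg1 x Ux)).
apply: Ck_congr (CkD Uo (IH _ _ (CkW cf) dg2) (IH _ _ (CkW cg) df2)) => // x.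
by rewrite inE => Ux /=; rewrite (deriveM (df1 x Ux) (dg1 x Ux)).
Qed.

(** * Smooth functions and the symmetry of second derivatives *)

Lemma smooth_congr U f g : open U -> {in U, f =1 g} -> smooth U f -> smooth U g.
Proof. by move=> Uo fg sf k; exact: Ck_congr (sf k). Qed.

Lemma smooth_sub U U' f : U' `<=` U -> smooth U f -> smooth U' f.
Proof. by move=> UU' sf k; exact: Ck_sub (sf k). Qed.

Lemma smooth_cst U c : smooth U (cst c).
Proof. by move=> k; exact: Ck_cst. Qed.

Lemma smoothD U f g : open U -> smooth U f -> smooth U g -> smooth U (f \+ g).
Proof. by move=> Uo sf sg k; apply: CkD. Qed.

Lemma smoothM U f g : open U -> smooth U f -> smooth U g -> smooth U (f \* g).
Proof. by move=> Uo sf sg k; apply: CkM. Qed.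

Lemma smooth_sum U (I : finType) (F : I -> 'rV[R]_n -> R) : open U ->
  (forall i, smooth U (F i)) -> smooth U (fun x => \sum_i F i x).
Proof.
move=> Uo sF; rewrite (_ : (fun x => _) = \big[(fun f g => f \+ g)/cst 0]_i F i).
  apply: big_ind => [|f g|i _ //]; first exact: smooth_cst.
  exact: smoothD.
by apply/funext => x; elim/big_rec2 : _ => //= i f g _ ->.
Qed.

Lemma smooth_derive U f i : smooth U f -> smooth U (fun x => 'D_(delta_mx 0 i) f x).
Proof. by move=> sf k; have [_ /(_ i)[]] := sf k.+1. Qed.

Lemma smooth_differentiable U f x : open U -> U x -> smooth U f ->
  differentiable f x.
Proof. by move=> Uo Ux sf; exact: C1_differentiable (sf 1%N). Qed.

Lemma derivable_translate f (w : 'rV[R]_n) x v :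
  derivable f (w + x) v -> is_derive x v (fun y => f (w + y)) ('D_v f (w + x)).
Proof.
move=> df.
have E : (fun h => h^-1 *: (((fun y => f (w + y)) \o shift x) (h *: v) - f (w + x)))
    = (fun h => h^-1 *: ((f \o shift (w + x)) (h *: v) - f (w + x))).
  by apply/funext => h /=; rewrite addrCA.
by split; [rewrite /derivable E|rewrite /derive E].
Qed.

(** The mean value theorem is used twice: along [e i] for the increment [f (a e_j + y) - f y], then
    along [e j] for the [i]-th partial derivative. *)
Lemma second_difference U f x i j (a : R) : open U -> smooth U f ->
  let e := fun k : 'I_n => delta_mx 0 k : 'rV[R]_n in
  (forall s t, `|s| <= `|a| -> `|t| <= `|a| -> U (t *: e j + (s *: e i + x))) ->
  exists s t, [/\ `|s| <= `|a|, `|t| <= `|a| &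
    f (a *: e j + (a *: e i + x)) - f (a *: e i + x) - (f (a *: e j + x) - f x) =
    a * (a * 'D_(e j) ('D_(e i) f) (t *: e j + (s *: e i + x)))].
Proof.
move=> Uo sf e inU.
have df y : U y -> derivable f y (e i).
  by move=> Uy; apply: diff_derivable; exact: smooth_differentiable sf.
have phi s : `|s| <= `|a| -> is_derive (s *: e i + x) (e i)
    (fun y => f (a *: e j + y) - f y)
    ('D_(e i) f (a *: e j + (s *: e i + x)) - 'D_(e i) f (s *: e i + x)).
  move=> sa; apply: (@is_deriveB _ _ _ (fun y => f (a *: e j + y)) f).
    by apply: derivable_translate; apply: df; exact: inU.
  apply: derivableP; apply: df.
  by have := inU s 0 sa; rewrite scale0r add0r normr0; apply.
have [s sa ->] := MVT_line (fun s sa => @ex_derive _ _ _ _ _ _ _ (phi s sa)).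
have [t ta E] : exists2 t, `|t| <= `|a| &
    'D_(e i) f (a *: e j + (s *: e i + x)) - 'D_(e i) f (s *: e i + x) =
    a * 'D_(e j) ('D_(e i) f) (t *: e j + (s *: e i + x)).
  apply: (@MVT_line ('D_(e i) f) (s *: e i + x) (e j) a) => t ta.
  apply: diff_derivable.
  by apply: (smooth_differentiable Uo (inU _ _ sa ta)); exact: smooth_derive.
by exists s, t; split => //; rewrite (@derive_val _ _ _ _ _ _ _ (phi s sa)) E.
Qed.

(** The second difference is symmetric in [i] and [j], so the two mixed derivatives take a common
    value at two points near [x]. If they differed at [x], continuity would keep these values
    apart. *)
Lemma schwarz U f x i j : open U -> U x -> smooth U f ->
  'D_(delta_mx 0 j) ('D_(delta_mx 0 i) f) x =
  'D_(delta_mx 0 i) ('D_(delta_mx 0 j) f) x.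
Proof.
move=> Uo Ux sf; set e := fun k : 'I_n => delta_mx 0 k : 'rV[R]_n.
set A := LHS; set B := RHS; apply/eqP; rewrite -subr_eq0 -normr_le0 leNgt.
apply/negP => d0; have d20 : 0 < `|A - B| / 2 by rewrite divr_gt0.
pose Q y := [/\ U y, `|A - 'D_(e j) ('D_(e i) f) y| < `|A - B| / 2 &
                     `|B - 'D_(e i) ('D_(e j) f) y| < `|A - B| / 2].
have near2 k l : \forall y \near nbhs x,
    `|'D_(e l) ('D_(e k) f) x - 'D_(e l) ('D_(e k) f) y| < `|A - B| / 2.
  have [c _] := smooth_derive l (smooth_derive k sf) 0%N.
  by have /cvgrPdist_lt := c x Ux; apply.
have nU : nbhs x U by exact: open_nbhs_nbhs.
have /nbhs_ballP[r /= r0 rQ] : nbhs x Q.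
  apply: (@filterS3 _ _ (nbhs_filter x) _ _ _ _ _ nU (near2 i j) (near2 j i)).
  by move=> y u1 u2 u3; exact: (And3 u1 u2 u3).
(* Two moves of length at most [r / 4] stay inside the ball of radius [r]. *)
pose a := r / 4.
have aa : `|a| = r / 4 by rewrite ger0_norm ?divr_ge0 ?ltW.
have e1 k : `|e k| <= 1.
  by apply: rV_norm_le => // l; rewrite mxE; case: andP; rewrite ?normr1 ?normr0.
have inQ k l s t : `|s| <= `|a| -> `|t| <= `|a| ->
    Q (t *: e l + (s *: e k + x)).
  move=> sa ta; apply: rQ; rewrite -ball_normE /= distrC addrA addrK.
  apply: le_lt_trans (ler_normD _ _) _; rewrite !normrZ.
  have := ler_pM (normr_ge0 _) (normr_ge0 _) sa (e1 k).
  have := ler_pM (normr_ge0 _) (normr_ge0 _) ta (e1 l).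
  rewrite !mulr1 aa => h1 h2; apply: le_lt_trans (lerD h1 h2) _; lra.
have [|s [t [sa ta E1]]] := @second_difference U f x i j a Uo sf.
  by move=> s t sa ta; have [] := inQ i j s t sa ta.
have [|s' [t' [sa' ta' E2]]] := @second_difference U f x j i a Uo sf.
  by move=> s' t' sa' ta'; have [] := inQ j i s' t' sa' ta'.
have [_ q1 _] := inQ i j s t sa ta; have [_ _ q2] := inQ j i s' t' sa' ta'.
have a0 : a != 0 by rewrite -normr_gt0 aa divr_gt0.
move: E1 E2 q1 q2; rewrite -/(e i) -/(e j).
move: ('D_(e j) ('D_(e i) f) _) => D1; move: ('D_(e i) ('D_(e j) f) _) => D2 E1 E2 q1 q2.
have EE : a * (a * D1) = a * (a * D2).
  by rewrite -E1 -E2 [a *: e j + (a *: e i + x)]addrCA; ring.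
move/(mulfI a0)/(mulfI a0): EE q1 => ->  q1.
have := ler_normB (A - D2) (B - D2).
rewrite opprB subrKA => hn; move: (le_lt_trans hn (ltrD q1 q2)).
by rewrite -splitr ltxx.
Qed.

End Calculus.

(** * Vector fields on a manifold *)

Section RowVectorCalculus.
Context {R : realType} {n : nat}.

Lemma derivable_rV (f : 'rV[R]_n -> 'rV[R]_n) x v :
  (forall k, derivable (fun y => f y 0 k) x v) -> derivable f x v.
Proof. by move=> df; apply/derivable_mxP => i j; rewrite ord1. Qed.

Lemma derive_rV (f : 'rV[R]_n -> 'rV[R]_n) x v k :
  (forall k, derivable (fun y => f y 0 k) x v) ->
  ('D_v f x) 0 k = 'D_v (fun y => f y 0 k) x.
Proof. by move=> df; rewrite derive_mx ?mxE//; exact: derivable_rV. Qed.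

Lemma differentiable_rV (f : 'rV[R]_n -> 'rV[R]_n) x :
  (forall k, differentiable (fun y => f y 0 k) x) -> differentiable f x.
Proof.
move=> df.
rewrite (_ : f = \sum_(k < n) (fun y => f y 0 k *: (delta_mx 0 k : 'rV[R]_n))).
  by apply: differentiable_sum => k; exact: differentiableZl.
by apply/funext => y; rewrite fct_sumE [LHS]row_sum_delta.
Qed.

Lemma derive_coord (x v : 'rV[R]_n) k : 'D_v (fun y : 'rV[R]_n => y 0 k) x = v 0 k.
Proof.
have := @derive_rV id x v k; rewrite derive_id => -> // l.
by apply: diff_derivable; exact: differentiable_coord.
Qed.

Lemma rV_subE (u v : 'rV[R]_n) k : (u - v) 0 k = u 0 k - v 0 k.
Proof. by rewrite !mxE. Qed.

(** The coordinate form of [[X, Y] f = X Y f - Y X f]: [d] is the gradient of [f], [H] its Hessian,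
    [x] and [y] the components of the fields, [a] the derivatives of those of [Y] along [X], and [b]
    the reverse. Symmetry of [H] cancels the second-order terms. *)
Lemma sum_second_derivatives_cancel (K : comPzRingType) (a b d x y : 'I_n -> K)
    (H : 'I_n -> 'I_n -> K) : (forall k l, H k l = H l k) ->
  \sum_k (a k - b k) * d k =
  \sum_k (a k * d k + y k * \sum_l x l * H l k) -
  \sum_k (b k * d k + x k * \sum_l y l * H l k).
Proof.
move=> HC; rewrite !big_split /= opprD addrACA -sumrB.
rewrite [X in _ = _ + X](_ : _ = 0) ?addr0.
  by apply: eq_bigr => k _; rewrite mulrBl.
apply/eqP; rewrite subr_eq0; apply/eqP.
under eq_bigr do rewrite mulr_sumr; under [RHS]eq_bigr do rewrite mulr_sumr.
rewrite exchange_big /=; apply: eq_bigr => k _; apply: eq_bigr => l _.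
by rewrite HC mulrCA.
Qed.

Lemma rV_addE (u v : 'rV[R]_n) k : (u + v) 0 k = u 0 k + v 0 k.
Proof. by rewrite !mxE. Qed.

(** The cancellation behind the Jacobi identity: the letters are the third-order derivatives of a
    function for the six orders of three fields. *)
Lemma alternating_sum6_eq0 (a b c d e f : R) :
  (a - b - (c - d)) + (c - e - (f - b)) + (f - d - (a - e)) = 0.
Proof. ring. Qed.

End RowVectorCalculus.

Section Manifold.
Context {R : realType} {n : nat} {M : topologicalType} (A : smooth_atlas R n M).
Implicit Types (V : set M) (p q : M) (v : 'rV[R]_n) (f g : M -> R)
  (X Y Z : M -> 'rV[R]_n) (i j : chart_index A).

Lemma open_chart_image i V : open V -> open (chart i @` (dom i `&` V)).
Proof.
move=> Vo; rewrite openE => _ [p [ip Vp] <-] /=; rewrite /interior.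
have xi : (chart i @` dom i) (chart i p) by exists p.
have nV : nbhs (param i (chart i p)) V by rewrite paramK//; exact: open_nbhs_nbhs.
have n1 := param_continuous xi nV.
have n2 : nbhs (chart i p) (chart i @` dom i).
  by apply: open_nbhs_nbhs; split => //; exact: image_open.
apply: (@filterS2 _ _ (nbhs_filter (chart i p)) _ _ _ _ n1 n2) => y /= Vy [q iq qy].
by exists q => //; split => //; rewrite -(paramK iq) qy.
Qed.

Arguments open_chart_image i [V] _.

Lemma chart_imageP i V p : dom i p -> V p -> (chart i @` (dom i `&` V)) (chart i p).
Proof. by move=> ip Vp; exists p. Qed.

Lemma chart_image_sub i V V' : V `<=` V' ->
  chart i @` (dom i `&` V) `<=` chart i @` (dom i `&` V').
Proof. by move=> VV' _ [p [ip /VV' Vp] <-]; exists p. Qed.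

Lemma dd_congr (W : normedModType R) V (f g : M -> W) p v : open V -> V p ->
  {in V, f =1 g} -> dd A p v f = dd A p v g.
Proof.
move=> Vo Vp fg; have cp := chart_atP A p.
apply: (derive_congr _ (open_chart_image (chart_at A p) Vo) (chart_imageP cp Vp)).
by move=> x; rewrite inE => -[q [cq Vq] <-] /=; rewrite paramK// fg ?inE.
Qed.

Lemma smooth_fun_congr V f g : open V -> {in V, f =1 g} ->
  smooth_fun A V f -> smooth_fun A V g.
Proof.
move=> Vo fg sf i; apply: smooth_congr (sf i); first exact: open_chart_image.
by move=> x; rewrite inE => -[q [cq Vq] <-] /=; rewrite paramK// fg ?inE.
Qed.

Lemma smooth_fun_sub V V' f : V' `<=` V -> smooth_fun A V f -> smooth_fun A V' f.
Proof. by move=> VV' sf i; apply: smooth_sub (sf i); exact: chart_image_sub. Qed.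

Lemma smooth_fun_cst V c : smooth_fun A V (fun=> c).
Proof. by move=> i; exact: smooth_cst. Qed.

Lemma smooth_funD V f g : open V -> smooth_fun A V f -> smooth_fun A V g ->
  smooth_fun A V (fun p => f p + g p).
Proof.
move=> Vo sf sg i.
exact: (smoothD (open_chart_image i Vo) (sf i) (sg i)).
Qed.

Lemma smooth_funM V f g : open V -> smooth_fun A V f -> smooth_fun A V g ->
  smooth_fun A V (fun p => f p * g p).
Proof.
move=> Vo sf sg i.
exact: (smoothM (open_chart_image i Vo) (sf i) (sg i)).
Qed.

Lemma smooth_fun_sum V (I : finType) (F : I -> M -> R) : open V ->
  (forall k, smooth_fun A V (F k)) -> smooth_fun A V (fun p => \sum_k F k p).
Proof.
move=> Vo sF i.
exact: (smooth_sum (open_chart_image i Vo) (fun k => sF k i)).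
Qed.

Lemma smooth_fun_differentiable V f p i : open V -> V p -> dom i p ->
  smooth_fun A V f -> differentiable (f \o param i) (chart i p).
Proof.
move=> Vo Vp ip sf.
exact: (smooth_differentiable (open_chart_image i Vo) (chart_imageP ip Vp) (sf i)).
Qed.

Definition coord i (k : 'I_n) q : R := chart i q 0 k.

Definition dr p v f : R := dd A p v f.

Lemma smooth_coord i k : smooth_fun A (dom i) (coord i k).
Proof. by move=> j; exact: transition_smooth. Qed.

Lemma chart_differentiable i j p : dom i p -> dom j p ->
  differentiable (chart j \o param i) (chart i p).
Proof.
move=> ip jp; apply: differentiable_rV => k.
exact: (smooth_fun_differentiable (@dom_open _ _ _ _ j) jp ip (smooth_coord j k)).
Qed.

(** The chain rule through the transition map. [dd] uses the preferred chart of [p], which varies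
    with [p] without any regularity; a fixed chart [i] makes the dependence on [p] tractable. *)
Lemma dd_chart V f p v i : open V -> V p -> dom i p -> smooth_fun A V f ->
  dd A p v f = 'D_(dd A p v (chart i)) (f \o param i) (chart i p).
Proof.
move=> Vo Vp ip sf; set c := chart_at A p; have cp : dom c p := chart_atP A p.
have Do := @dom_open _ _ _ A i.
have dt := chart_differentiable cp ip.
have Et : (chart i \o param c) (chart c p) = chart i p by rewrite /= paramK.
have df : differentiable (f \o param i) ((chart i \o param c) (chart c p)).
  by rewrite Et; exact: smooth_fun_differentiable sf.
have E : dd A p v (chart i) = 'd (chart i \o param c) (chart c p) v.
  by rewrite /dd deriveE.
rewrite deriveE -Et// E -[RHS]/(('d _ _ \o 'd _ _) v) -diff_comp//.
rewrite -deriveE; last exact: differentiable_comp.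
apply: (derive_congr _ (open_chart_image c Do) (chart_imageP cp ip)).
by move=> x; rewrite inE => -[q [cq iq] <-] /=; rewrite (paramK cq) (paramK iq).
Qed.


Lemma dd_rV p v (F : M -> 'rV[R]_n) k :
  (forall k, differentiable ((fun q => F q 0 k : R) \o param (chart_at A p))
     (chart (chart_at A p) p)) ->
  (dd A p v F) 0 k = dr p v (fun q => F q 0 k).
Proof.
move=> dF; rewrite /dr /dd derive_rV// => l; apply: diff_derivable; exact: dF.
Qed.

Lemma dd_chart_coord p v i k : dom i p ->
  (dd A p v (chart i)) 0 k = dr p v (coord i k).
Proof.
move=> ip; apply: dd_rV => l.
exact: (smooth_fun_differentiable (@dom_open _ _ _ _ i) ip (chart_atP A p) (smooth_coord i l)).
Qed.

Lemma dr_coordE V f p v i : open V -> V p -> dom i p -> smooth_fun A V f ->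
  dr p v f = \sum_k dr p v (coord i k) *
                 'D_(delta_mx 0 k) (f \o param i) (chart i p).
Proof.
move=> Vo Vp ip sf; rewrite [LHS](dd_chart _ Vo Vp ip sf) derive_coordE//.
  by apply: eq_bigr => k _; rewrite dd_chart_coord.
exact: smooth_fun_differentiable sf.
Qed.

Lemma dr_chart_at p v k : dr p v (coord (chart_at A p) k) = v 0 k.
Proof.
set c := chart_at A p; have cp : dom c p := chart_atP A p.
rewrite /dr /dd -/c -(derive_coord (chart c p)).
apply: (derive_congr _ (open_chart_image c (@dom_open _ _ _ _ c)) (chart_imageP cp cp)).
by move=> x; rewrite inE => -[q [cq _] <-]; rewrite /coord /= paramK.
Qed.

Lemma dr_congr V f g p v : open V -> V p -> {in V, f =1 g} -> dr p v f = dr p v g.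
Proof. exact: dd_congr. Qed.

Lemma dr_linear V f p a u v : open V -> V p -> smooth_fun A V f ->
  dr p (a *: u + v) f = a * dr p u f + dr p v f.
Proof.
move=> Vo Vp sf; have cp := chart_atP A p.
have df := smooth_fun_differentiable Vo Vp cp sf.
by rewrite /dr /dd !deriveE// linearP.
Qed.

Lemma dr_cst p v (c : R) : dr p v (fun=> c) = 0.
Proof. exact: derive_cst. Qed.

Lemma drD V f g p v : open V -> V p -> smooth_fun A V f -> smooth_fun A V g ->
  dr p v (fun q => f q + g q) = dr p v f + dr p v g.
Proof.
move=> Vo Vp sf sg; have cp := chart_atP A p.
have df := diff_derivable (v := v) (smooth_fun_differentiable Vo Vp cp sf).
have dg := diff_derivable (v := v) (smooth_fun_differentiable Vo Vp cp sg).
exact: (deriveD df dg).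
Qed.

Lemma drM V f g p v : open V -> V p -> smooth_fun A V f -> smooth_fun A V g ->
  dr p v (fun q => f q * g q) = dr p v f * g p + f p * dr p v g.
Proof.
move=> Vo Vp sf sg; have cp := chart_atP A p.
have df := diff_derivable (v := v) (smooth_fun_differentiable Vo Vp cp sf).
have dg := diff_derivable (v := v) (smooth_fun_differentiable Vo Vp cp sg).
rewrite [LHS](deriveM df dg) /= (paramK cp) addrC; congr (_ + _).
exact: mulrC.
Qed.

Lemma drZ V f p v (c : R) : open V -> V p -> smooth_fun A V f ->
  dr p v (fun q => c * f q) = c * dr p v f.
Proof.
by move=> Vo Vp sf; rewrite (drM _ Vo Vp (smooth_fun_cst _ c) sf) dr_cst mul0r add0r.
Qed.

Lemma smooth_funZ V f (c : R) : open V -> smooth_fun A V f ->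
  smooth_fun A V (fun q => c * f q).
Proof. by move=> Vo; apply: smooth_funM => //; exact: smooth_fun_cst. Qed.

Lemma smooth_funB V f g : open V -> smooth_fun A V f -> smooth_fun A V g ->
  smooth_fun A V (fun p => f p - g p).
Proof.
move=> Vo sf sg; apply: smooth_funD => //.
apply: smooth_fun_congr (smooth_funZ (-1) Vo sg) => // q _.
by rewrite mulN1r.
Qed.

Lemma drB V f g p v : open V -> V p -> smooth_fun A V f -> smooth_fun A V g ->
  dr p v (fun q => f q - g q) = dr p v f - dr p v g.
Proof.
move=> Vo Vp sf sg; rewrite -[- dr p v g]mulN1r -(drZ _ _ Vo Vp sg).
rewrite -(drD _ Vo Vp sf (smooth_funZ _ Vo sg)).
by apply: (dr_congr _ Vo Vp) => q _; rewrite mulN1r.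
Qed.

Lemma dr_sum V (I : finType) (F : I -> M -> R) p v : open V -> V p ->
  (forall k, smooth_fun A V (F k)) ->
  dr p v (fun q => \sum_k F k q) = \sum_k dr p v (F k).
Proof.
move=> Vo Vp sF.
have cp := chart_atP A p.
suff H : forall r : seq I, smooth_fun A V (fun q => \sum_(k <- r) F k q) /\
    dr p v (fun q => \sum_(k <- r) F k q) = \sum_(k <- r) dr p v (F k).
  by have [] := H (index_enum I).
elim=> [|k r [s IH]].
  under eq_fun do rewrite big_nil; split; first exact: smooth_fun_cst.
  by rewrite big_nil dr_cst.
under eq_fun do rewrite big_cons; split; first exact: smooth_funD.
by rewrite (drD _ Vo Vp (sF k) s) IH big_cons.
Qed.

Lemma smooth_vfP V X : open V ->
  (forall i k, smooth_fun A (V `&` dom i) (fun p => dr p (X p) (coord i k))) ->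
  smooth_vf A V X.
Proof.
move=> Vo sX i k; have Wo : open (V `&` dom i) by apply: openI => //; exact: dom_open.
by apply: smooth_fun_congr (sX i k) => // q; rewrite inE => -[Vq iq]; rewrite -dd_chart_coord.
Qed.

Lemma smooth_vf_coord V X : open V -> smooth_vf A V X ->
  forall i k, smooth_fun A (V `&` dom i) (fun p => dr p (X p) (coord i k)).
Proof.
move=> Vo sX i k; have Wo : open (V `&` dom i) by apply: openI => //; exact: dom_open.
by apply: smooth_fun_congr (sX i k) => // q; rewrite inE => -[Vq iq]; rewrite -dd_chart_coord.
Qed.

Lemma smooth_funP V f :
  smooth_fun A V f <-> forall i, smooth (chart i @` (dom i `&` V)) (f \o param i).
Proof. by []. Qed.

Lemma drE p v f :
  dr p v f = 'D_v (f \o param (chart_at A p)) (chart (chart_at A p) p).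
Proof. by []. Qed.

Opaque smooth_fun smooth_vf dr dd.

Lemma smooth_vf_sub V V' X : open V -> open V' -> V' `<=` V ->
  smooth_vf A V X -> smooth_vf A V' X.
Proof.
move=> Vo Vo' VV' sX; apply: smooth_vfP => // i k.
by apply: smooth_fun_sub (smooth_vf_coord Vo sX i k); exact: setSI.
Qed.

Lemma dr0 p f : dr p 0 f = 0.
Proof. exact: derive0. Qed.

Lemma smooth_vfD V X Y : open V -> smooth_vf A V X -> smooth_vf A V Y ->
  smooth_vf A V (fun q => X q + Y q).
Proof.
move=> Vo sX sY; apply: smooth_vfP => // i k.
have Wo : open (V `&` dom i) by apply: openI => //; exact: dom_open.
apply: smooth_fun_congr (smooth_funD Wo (smooth_vf_coord Vo sX i k)
  (smooth_vf_coord Vo sY i k)) => // q.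
rewrite inE => -[Vq iq]; rewrite -[X q in RHS]scale1r.
by rewrite (dr_linear _ _ _ (@dom_open _ _ _ _ i) iq (smooth_coord i k)) mul1r.
Qed.

Lemma smooth_vfZ V f X : open V -> smooth_fun A V f -> smooth_vf A V X ->
  smooth_vf A V (fun q => f q *: X q).
Proof.
move=> Vo sf sX; apply: smooth_vfP => // i k.
have Wo : open (V `&` dom i) by apply: openI => //; exact: dom_open.
have sf' : smooth_fun A (V `&` dom i) f by apply: smooth_fun_sub sf => q [].
apply: smooth_fun_congr (smooth_funM Wo sf' (smooth_vf_coord Vo sX i k)) => // q.
rewrite inE => -[Vq iq]; rewrite -[f q *: X q]addr0.
by rewrite (dr_linear _ _ _ (@dom_open _ _ _ _ i) iq (smooth_coord i k)) dr0 addr0.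
Qed.

Lemma smooth_vf0 V : open V -> smooth_vf A V (fun=> 0).
Proof.
move=> Vo; apply: smooth_vfP => // i k.
rewrite (_ : (fun p => _) = fun=> 0); first exact: smooth_fun_cst.
by apply/funext => p; rewrite dr0.
Qed.

Lemma smooth_vf_sum V (I : finType) (F : I -> M -> 'rV[R]_n) : open V ->
  (forall k, smooth_vf A V (F k)) -> smooth_vf A V (fun q => \sum_k F k q).
Proof.
move=> Vo sF; elim: (index_enum I) => [|k r IH].
  by under eq_fun do rewrite big_nil; exact: smooth_vf0.
by under eq_fun do rewrite big_cons; exact: (smooth_vfD Vo (sF k) IH).
Qed.

Lemma smooth_vfB V X Y : open V -> smooth_vf A V X -> smooth_vf A V Y ->
  smooth_vf A V (fun q => X q - Y q).
Proof.
move=> Vo sX sY; rewrite (_ : (fun q => _) = fun q => X q + (-1) *: Y q).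
  exact: (smooth_vfD Vo sX (smooth_vfZ Vo (@smooth_fun_cst V (-1)) sY)).
by apply/funext => q; rewrite scaleN1r.
Qed.

Lemma smooth_vf_congr V X Y : open V -> {in V, X =1 Y} ->
  smooth_vf A V X -> smooth_vf A V Y.
Proof.
move=> Vo XY sX; apply: smooth_vfP => // i k.
have Wo : open (V `&` dom i) by apply: openI => //; exact: dom_open.
apply: smooth_fun_congr (smooth_vf_coord Vo sX i k) => // q.
by rewrite inE => -[Vq _]; rewrite XY ?inE.
Qed.

Lemma smooth_dr V f X : open V -> smooth_vf A V X -> smooth_fun A V f ->
  smooth_fun A V (fun q => dr q (X q) f).
Proof.
move=> Vo sX sf; apply/smooth_funP => i; have Uo := open_chart_image i Vo.
apply: (@smooth_congr _ _ _ (fun x => \sum_k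
    ((fun q => dr q (X q) (coord i k)) \o param i) x *
    'D_(delta_mx 0 k) (f \o param i) x)) => //.
  move=> x; rewrite inE => -[q [iq Vq] <-] /=; rewrite (paramK iq).
  by rewrite (dr_coordE _ Vo Vq iq sf).
apply: smooth_sum => // k; apply: smoothM => //; last first.
  by apply: smooth_derive; move/smooth_funP : sf.
have /smooth_funP/(_ i) := smooth_vf_coord Vo sX i k.
by apply: smooth_sub => _ [q [iq Vq] <-]; exists q.
Qed.

(** * The Lie bracket as a commutator of derivations *)

Lemma lie_coord V X Y p k : open V -> V p -> smooth_vf A V X -> smooth_vf A V Y ->
  lie A X Y p 0 k =
    dr p (X p) (fun q => dr q (Y q) (coord (chart_at A p) k))
  - dr p (Y p) (fun q => dr q (X q) (coord (chart_at A p) k)).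
Proof.
move=> Vo Vp sX sY; have cp := chart_atP A p.
have Wo : open (V `&` dom (chart_at A p)) by apply: openI => //; exact: dom_open.
have E v Z : smooth_vf A V Z ->
    (dd A p v (fun q => dd A q (Z q) (chart (chart_at A p)))) 0 k =
    dr p v (fun q => dr q (Z q) (coord (chart_at A p) k)).
  move=> sZ; rewrite dd_rV.
    apply: (dr_congr _ Wo (conj Vp cp)) => q; rewrite inE => -[Vq cq].
    by rewrite dd_chart_coord.
  move=> l; apply: (smooth_fun_differentiable Wo (conj Vp cp) cp).
  apply: smooth_fun_congr (smooth_vf_coord Vo sZ (chart_at A p) l) => // q.
  by rewrite inE => -[Vq cq]; rewrite dd_chart_coord.
by rewrite -(E _ _ sX) -(E _ _ sY) /lie; exact: rV_subE.
Qed.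

Opaque lie.

(** The computation takes place in the preferred chart of [p], held fixed while the point moves. The
    Hessian terms cancel by [schwarz], and what remains is the coordinate formula of the bracket. *)
Lemma dr_lie V f X Y p : open V -> V p -> smooth_vf A V X -> smooth_vf A V Y ->
  smooth_fun A V f ->
  dr p (lie A X Y p) f =
    dr p (X p) (fun q => dr q (Y q) f) - dr p (Y p) (fun q => dr q (X q) f).
Proof.
move=> Vo Vp sX sY sf; pose c := chart_at A p; have cp : dom c p := chart_atP A p.
have Wo : open (V `&` dom c) by apply: openI => //; exact: dom_open.
have Wp : (V `&` dom c) p by split.
have Uo := open_chart_image c Wo; have Up := chart_imageP cp Wp.
have sF : smooth (chart c @` (dom c `&` (V `&` dom c))) (f \o param c).
  move/smooth_funP/(_ c) : sf; apply: smooth_sub; apply: chart_image_sub => q [] //.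
pose D k := 'D_(delta_mx 0 k) (f \o param c).
(* The product rule for the derivative along [v] of the sum of the [Z^k D k]. *)
have dX Z : smooth_vf A V Z -> forall v, dr p v (fun q => dr q (Z q) f) =
    \sum_k (dr p v (fun q => dr q (Z q) (coord c k)) * D k (chart c p) +
            Z p 0 k * \sum_l v 0 l * 'D_(delta_mx 0 l) (D k) (chart c p)).
  move=> sZ v; pose G k := (fun q => dr q (Z q) (coord c k)) \o param c.
  have sG k : smooth (chart c @` (dom c `&` (V `&` dom c))) (G k).
    by have /smooth_funP := smooth_vf_coord Vo sZ c k; apply.
  have dG k : derivable (G k) (chart c p) v.
    by apply: diff_derivable; exact: smooth_differentiable (sG k).
  have dD k : derivable (D k) (chart c p) v.
    apply: diff_derivable; apply: (smooth_differentiable Uo Up).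
    exact: smooth_derive.
  rewrite drE -/c (@derive_congr _ _ _ _ _ (\sum_k (G k * D k)) _ _ Uo Up).
    rewrite derive_sum; last by move=> k; exact: (derivableM (dG k) (dD k)).
    apply: eq_bigr => k _; rewrite (deriveM (dG k) (dD k)) addrC; congr (_ + _).
      by rewrite drE -/c; exact: mulrC.
    rewrite /G /= (paramK cp) -/c dr_chart_at.
    congr (_ * _); apply: derive_coordE.
    by apply: (smooth_differentiable Uo Up); exact: smooth_derive.
  move=> x; rewrite inE => -[q [cq [Vq _]] <-]; rewrite /= fct_sumE (paramK cq).
  rewrite (dr_coordE _ Vo Vq cq sf); apply: eq_bigr => k _.
  by rewrite [RHS]/(_ * _) /G /= (paramK cq).
rewrite (dX Y sY) (dX X sX) -sum_second_derivatives_cancel.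
  rewrite (dr_coordE _ Vo Vp cp sf) -/c; apply: eq_bigr => k _.
  by rewrite dr_chart_at (lie_coord k Vo Vp sX sY).
by move=> k l; exact: (schwarz _ _ Uo Up sF).
Qed.

(** A vector is determined by its action on the coordinate functions of the preferred chart, where
    iterated brackets become commutators of derivations. Smoothness of the brackets will be supplied
    by the Levi-Civita connection, through differences of covariant derivatives. *)
Lemma jacobi V X Y Z p : open V -> V p ->
  smooth_vf A V X -> smooth_vf A V Y -> smooth_vf A V Z ->
  smooth_vf A V (lie A X Y) -> smooth_vf A V (lie A Y Z) -> smooth_vf A V (lie A Z X) ->
  lie A X (lie A Y Z) p + lie A Y (lie A Z X) p + lie A Z (lie A X Y) p = 0.
Proof.
move=> Vo Vp sX sY sZ sXY sYZ sZX; apply/rowP => k; rewrite [RHS]mxE.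
pose c := chart_at A p; have cp : dom c p := chart_atP A p.
have Wo : open (V `&` dom c) by apply: openI => //; exact: dom_open.
have Wp : (V `&` dom c) p by split.
have sW U : smooth_vf A V U -> smooth_vf A (V `&` dom c) U.
  by apply: smooth_vf_sub => // q [].
move/sW: sX => sX; move/sW: sY => sY; move/sW: sZ => sZ.
move/sW: sXY => sXY; move/sW: sYZ => sYZ; move/sW: sZX => sZX.
have sf : smooth_fun A (V `&` dom c) (coord c k).
  by apply: smooth_fun_sub (smooth_coord c k) => q [].
have E X1 Y1 Z1 : smooth_vf A (V `&` dom c) X1 -> smooth_vf A (V `&` dom c) Y1 ->
    smooth_vf A (V `&` dom c) Z1 -> smooth_vf A (V `&` dom c) (lie A Y1 Z1) ->
    lie A X1 (lie A Y1 Z1) p 0 k =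
    dr p (X1 p) (fun q => dr q (Y1 q) (fun q => dr q (Z1 q) (coord c k))) -
    dr p (X1 p) (fun q => dr q (Z1 q) (fun q => dr q (Y1 q) (coord c k))) -
    (dr p (Y1 p) (fun q => dr q (Z1 q) (fun q => dr q (X1 q) (coord c k))) -
     dr p (Z1 p) (fun q => dr q (Y1 q) (fun q => dr q (X1 q) (coord c k)))).
  move=> s1 s2 s3 s4; rewrite -(dr_chart_at p) -/c.
  rewrite (dr_lie Wo Wp s1 s4 sf); congr (_ - _).
    rewrite -(drB _ Wo Wp); [|by do 2!apply: smooth_dr => //..].
    apply: (dr_congr _ Wo Wp) => q; rewrite inE => Wq.
    by rewrite (dr_lie Wo Wq s2 s3 sf).
  by rewrite (dr_lie Wo Wp s2 s3)//; exact: smooth_dr.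
rewrite (rV_addE (_ + _)) (rV_addE (lie A X _ p)).
apply: (etrans (congr2 +%R (congr2 +%R (E X Y Z sX sY sZ sYZ)
  (E Y Z X sY sZ sX sZX)) (E Z X Y sZ sX sY sXY))).
exact: alternating_sum6_eq0.
Qed.

End Manifold.

(** * Curvature of a metric connection with parallel skew torsion *)

(* The Lie-Rinehart algebra of the smooth fields [SX] over the smooth functions
   [SF] on an open set [V], with a metric connection [nab] whose torsion [Tv] is
   skew-symmetric and parallel. All equations hold on [V] only. *)
Record skew_torsion_calculus (R : realType) (n : nat) (M : Type) (V : set M)
  (SF : (M -> R) -> Prop) (SX : (M -> 'rV[R]_n) -> Prop)
  (dr : M -> 'rV[R]_n -> (M -> R) -> R)
  (lie : (M -> 'rV[R]_n) -> (M -> 'rV[R]_n) -> M -> 'rV[R]_n)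
  (nab : M -> 'rV[R]_n -> (M -> 'rV[R]_n) -> 'rV[R]_n)
  (g : M -> 'rV[R]_n -> 'rV[R]_n -> R)
  (Tv : M -> 'rV[R]_n -> 'rV[R]_n -> 'rV[R]_n) : Prop := SkewTorsionCalculus {
  SX_add : forall X Y, SX X -> SX Y -> SX (fun q => X q + Y q);
  SX_scale : forall f X, SF f -> SX X -> SX (fun q => f q *: X q);
  SX_nab : forall X Y, SX X -> SX Y -> SX (fun q => nab q (X q) Y);
  SX_lie : forall X Y, SX X -> SX Y -> SX (lie X Y);
  SX_torsion : forall X Y, SX X -> SX Y -> SX (fun q => Tv q (X q) (Y q));
  SF_dr : forall X f, SX X -> SF f -> SF (fun q => dr q (X q) f);
  SF_metric : forall X Y, SX X -> SX Y -> SF (fun q => g q (X q) (Y q));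
  dr_add : forall p v f h, V p -> SF f -> SF h ->
    dr p v (fun q => f q + h q) = dr p v f + dr p v h;
  dr_eq : forall p v f h, V p -> {in V, f =1 h} -> dr p v f = dr p v h;
  dr_bracket : forall p X Y f, V p -> SX X -> SX Y -> SF f ->
    dr p (lie X Y p) f = dr p (X p) (fun q => dr q (Y q) f) -
                         dr p (Y p) (fun q => dr q (X q) f);
  lie_jacobi : forall p X Y Z, V p -> SX X -> SX Y -> SX Z ->
    lie X (lie Y Z) p + lie Y (lie Z X) p + lie Z (lie X Y) p = 0;
  nab_eq : forall p v X Y, V p -> SX X -> SX Y -> {in V, X =1 Y} ->
    nab p v X = nab p v Y;
  nab_add : forall p v X Y, V p -> SX X -> SX Y ->
    nab p v (fun q => X q + Y q) = nab p v X + nab p v Y;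
  nab_scale : forall p v f X, V p -> SF f -> SX X ->
    nab p v (fun q => f q *: X q) = dr p v f *: X p + f p *: nab p v X;
  nab_linear : forall p a u v X, V p -> SX X ->
    nab p (a *: u + v) X = a *: nab p u X + nab p v X;
  nab_torsion : forall p X Y, V p -> SX X -> SX Y ->
    nab p (X p) Y - nab p (Y p) X = lie X Y p + Tv p (X p) (Y p);
  nab_metric : forall p v X Y, V p -> SX X -> SX Y ->
    dr p v (fun q => g q (X q) (Y q)) =
    g p (nab p v X) (Y p) + g p (X p) (nab p v Y);
  nab_Tv : forall p v X Y, V p -> SX X -> SX Y ->
    nab p v (fun q => Tv q (X q) (Y q)) =
    Tv p (nab p v X) (Y p) + Tv p (X p) (nab p v Y);
  inner_sym : forall p u v, g p u v = g p v u;
  inner_linear : forall p a u v w, g p (a *: u + v) w = a * g p u w + g p v w;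
  Tv_linear : forall p a u v w, Tv p (a *: u + v) w = a *: Tv p u w + Tv p v w;
  Tv_skew : forall p u v, Tv p v u = - Tv p u v;
  Tv_metric_skew : forall p u v w, V p -> g p (Tv p u v) w = - g p (Tv p u w) v
}.

Section Curvature.
Context {R : realType} {n : nat} {M : Type} {V : set M}
  {SF : (M -> R) -> Prop} {SX : (M -> 'rV[R]_n) -> Prop}
  {dr : M -> 'rV[R]_n -> (M -> R) -> R}
  {lie : (M -> 'rV[R]_n) -> (M -> 'rV[R]_n) -> M -> 'rV[R]_n}
  {nab : M -> 'rV[R]_n -> (M -> 'rV[R]_n) -> 'rV[R]_n}
  {g : M -> 'rV[R]_n -> 'rV[R]_n -> R}
  {Tv : M -> 'rV[R]_n -> 'rV[R]_n -> 'rV[R]_n}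
  (C : skew_torsion_calculus V SF SX dr lie nab g Tv).
Implicit Types (p : M) (u v w : 'rV[R]_n) (X Y Z W : M -> 'rV[R]_n).

(** Convertible with [curv] once [lie] is the bracket of the manifold. *)
Definition curvature X Y Z p : 'rV[R]_n :=
  nab p (X p) (fun q => nab q (Y q) Z) - nab p (Y p) (fun q => nab q (X q) Z)
  - nab p (lie X Y p) Z.

Let gD p u v w : g p (u + v) w = g p u w + g p v w.
Proof. by have := inner_linear C p 1 u v w; rewrite scale1r mul1r. Qed.

Let g0 p w : g p 0 w = 0.
Proof. by apply: (@addIr _ (g p 0 w)); rewrite -gD addr0 add0r. Qed.

Let gZ p a u w : g p (a *: u) w = a * g p u w.
Proof. by rewrite -[a *: u]addr0 (inner_linear C) g0 addr0. Qed.

Let gB p u v w : g p (u - v) w = g p u w - g p v w.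
Proof. by rewrite -scaleN1r gD gZ mulN1r. Qed.

Let TvD p u v w : Tv p (u + v) w = Tv p u w + Tv p v w.
Proof. by have := Tv_linear C p 1 u v w; rewrite !scale1r. Qed.

Let TvB p u v w : Tv p (u - v) w = Tv p u w - Tv p v w.
Proof. by rewrite addrC -scaleN1r (Tv_linear C) scaleN1r addrC. Qed.

Let nabD p u v X : V p -> SX X -> nab p (u + v) X = nab p u X + nab p v X.
Proof. by move=> Vp sX; have := nab_linear C 1 u v Vp sX; rewrite !scale1r. Qed.

Let nabB p u v X : V p -> SX X -> nab p (u - v) X = nab p u X - nab p v X.
Proof. by move=> Vp sX; rewrite addrC -scaleN1r (nab_linear C)// scaleN1r addrC. Qed.

(** The antisymmetry of the bracket is not an axiom of the calculus; it follows from the torsion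
    equation and the skewness of [Tv]. *)
Lemma curvature_swap X Y Z p : V p -> SX X -> SX Y -> SX Z ->
  curvature Y X Z p = - curvature X Y Z p.
Proof.
move=> Vp sX sY sZ.
have L : lie Y X p = - lie X Y p.
  have := nab_torsion C Vp sX sY; have := nab_torsion C Vp sY sX.
  rewrite (Tv_skew C p (X p) (Y p)) => E1 E2.
  apply: (@addIr _ (- Tv p (X p) (Y p))).
  by rewrite -E1 -opprD -E2 opprB.
rewrite /curvature L -[- lie X Y p]add0r nabB//.
have -> : nab p 0 Z = 0 by apply: (@addIr _ (nab p 0 Z)); rewrite -nabD// addr0 add0r.
move: (nab _ _ _) (nab _ _ _) (nab _ _ _) => a b c.
by apply/rowP => i; rewrite !mxE; ring.
Qed.

(** Apply the commutator rule for [X] and [Y] to the function [g (Z, W)]: metricity expands it, the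
    mixed first-order terms cancel, and the two curvature terms are left. *)
Lemma curvature_skew X Y Z W p : V p -> SX X -> SX Y -> SX Z -> SX W ->
  g p (curvature X Y Z p) (W p) = - g p (curvature X Y W p) (Z p).
Proof.
move=> Vp sX sY sZ sW.
have D2 U1 U2 : SX U1 -> SX U2 ->
  dr p (U1 p) (fun q => dr q (U2 q) (fun q => g q (Z q) (W q))) =
    g p (nab p (U1 p) (fun q => nab q (U2 q) Z)) (W p) +
    g p (nab p (U2 p) Z) (nab p (U1 p) W) +
    (g p (nab p (U1 p) Z) (nab p (U2 p) W) +
     g p (Z p) (nab p (U1 p) (fun q => nab q (U2 q) W))).
  move=> s1 s2; have sZ2 := SX_nab C s2 sZ; have sW2 := SX_nab C s2 sW.
  rewrite -(nab_metric C (U1 p) Vp sZ2 sW) -(nab_metric C (U1 p) Vp sZ sW2).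
  rewrite -(dr_add C)//; [|exact: (SF_metric C)|exact: (SF_metric C)].
  by apply: (dr_eq C) => // q; rewrite inE => Vq; rewrite (nab_metric C).
have := dr_bracket C Vp sX sY (SF_metric C sZ sW).
rewrite (D2 X Y sX sY) (D2 Y X sY sX) (nab_metric C)// /curvature !gB.
rewrite ![g p _ (Z p)](inner_sym C).
move: (g p _ _) (g p _ _) (g p _ _) (g p _ _) (g p _ _) (g p _ _) (g p _ _) (g p _ _).
by move=> *; lra.
Qed.

Lemma curvature_eq3 X Y Z Z' p : V p -> SX X -> SX Y -> SX Z -> SX Z' ->
  {in V, Z =1 Z'} -> curvature X Y Z p = curvature X Y Z' p.
Proof.
move=> Vp sX sY sZ sZ' ZZ'.
have E U : SX U -> {in V, (fun q => nab q (U q) Z) =1 (fun q => nab q (U q) Z')}.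
  by move=> sU q; rewrite inE => Vq; exact: (nab_eq C).
rewrite /curvature (nab_eq C _ Vp _ _ (E Y sY)); [|exact: (SX_nab C)|exact: (SX_nab C)].
rewrite (nab_eq C _ Vp _ _ (E X sX)); [|exact: (SX_nab C)|exact: (SX_nab C)].
by rewrite (nab_eq C _ Vp sZ sZ' ZZ').
Qed.

Lemma curvature_add3 X Y Z Z' p : V p -> SX X -> SX Y -> SX Z -> SX Z' ->
  curvature X Y (fun q => Z q + Z' q) p = curvature X Y Z p + curvature X Y Z' p.
Proof.
move=> Vp sX sY sZ sZ'.
have E U U' : SX U -> SX U' -> nab p (U p) (fun q => nab q (U' q) (fun q => Z q + Z' q)) =
    nab p (U p) (fun q => nab q (U' q) Z) + nab p (U p) (fun q => nab q (U' q) Z').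
  move=> sU sU'; have s1 := SX_nab C sU' sZ; have s2 := SX_nab C sU' sZ'.
  rewrite -(nab_add C)//; apply: (nab_eq C) => //.
  - exact: (SX_nab C sU' (SX_add C sZ sZ')).
  - exact: (SX_add C).
  - by move=> q; rewrite inE => Vq; rewrite (nab_add C).
rewrite /curvature !E// (nab_add C)// !opprD.
by rewrite [RHS]addrACA [X in _ = X + _]addrACA.
Qed.

(** Tensoriality in the third slot: the second derivatives of [f] cancel against the bracket term,
    the mixed first derivatives against each other. It allows a change of frame with variable
    coefficients. *)
Lemma curvature_scale3 X Y Z f p : V p -> SX X -> SX Y -> SX Z -> SF f ->
  curvature X Y (fun q => f q *: Z q) p = f p *: curvature X Y Z p.
Proof.
move=> Vp sX sY sZ sf.
have E U U' : SX U -> SX U' -> nab p (U p) (fun q => nab q (U' q) (fun q => f q *: Z q)) =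
    dr p (U p) (fun q => dr q (U' q) f) *: Z p + dr p (U' p) f *: nab p (U p) Z +
    (dr p (U p) f *: nab p (U' p) Z + f p *: nab p (U p) (fun q => nab q (U' q) Z)).
  move=> sU sU'; have s1 := SX_nab C sU' sZ; have s2 := SF_dr C sU' sf.
  rewrite -(nab_scale C)// -(nab_scale C)// -(nab_add C)//; last 2 first.
  - exact: (SX_scale C).
  - exact: (SX_scale C).
  apply: (nab_eq C) => //.
  - exact: (SX_nab C sU' (SX_scale C sf sZ)).
  - by apply: (SX_add C); exact: (SX_scale C).
  - by move=> q; rewrite inE => Vq; rewrite (nab_scale C).
rewrite /curvature !E// (nab_scale C)// (dr_bracket C)// scalerBl !scalerBr.
move: (nab _ _ _) (nab _ _ _) (nab _ _ _) (nab _ _ _) (nab _ _ _).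
by move=> *; apply/rowP => i; rewrite !mxE; ring.
Qed.

(** Each torsion equation is differentiated along the third field and the results are added
    cyclically; the iterated brackets vanish by Jacobi. Since the torsion is parallel, its covariant
    derivative contributes nothing and only the terms quadratic in [Tv] survive. *)
Lemma bianchi X Y Z p : V p -> SX X -> SX Y -> SX Z ->
  curvature X Y Z p + curvature Y Z X p + curvature Z X Y p =
  Tv p (Tv p (X p) (Y p)) (Z p) + Tv p (Tv p (Y p) (Z p)) (X p) +
  Tv p (Tv p (Z p) (X p)) (Y p).
Proof.
move=> Vp sX sY sZ.
(* The derivative along [U] of the torsion equation for [U1] and [U2], with [nab_U [U1, U2]]
   exchanged for [nab_[U1, U2] U]. Over cyclic triples the left sides regroup into the cyclic sum of
   curvatures. *)
have E U U1 U2 : SX U -> SX U1 -> SX U2 ->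
    nab p (U p) (fun q => nab q (U1 q) U2) - nab p (U p) (fun q => nab q (U2 q) U1)
    - nab p (lie U1 U2 p) U =
    lie U (lie U1 U2) p + Tv p (U p) (lie U1 U2 p) +
    (Tv p (nab p (U p) U1) (U2 p) - Tv p (nab p (U p) U2) (U1 p)).
  move=> s0 s1 s2; have s12 := SX_nab C s1 s2; have s21 := SX_nab C s2 s1.
  have sl := SX_lie C s1 s2; have sT := SX_torsion C s1 s2.
  have -> : nab p (lie U1 U2 p) U = nab p (U p) (lie U1 U2) -
      (lie U (lie U1 U2) p + Tv p (U p) (lie U1 U2 p)).
    by rewrite -(nab_torsion C Vp s0 sl) opprB addrC subrK.
  have -> : nab p (U p) (fun q => nab q (U1 q) U2) =
      nab p (U p) (fun q => nab q (U2 q) U1) + (nab p (U p) (lie U1 U2) +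
      nab p (U p) (fun q => Tv q (U1 q) (U2 q))).
    rewrite -!(nab_add C)//; last exact: (SX_add C).
    apply: (nab_eq C) => //; first exact: (SX_add C s21 (SX_add C sl sT)).
    move=> q; rewrite inE => Vq; rewrite -(nab_torsion C Vq s1 s2).
    by rewrite addrC subrK.
  rewrite (nab_Tv C)// -[Tv p (U1 p) _]opprK -(Tv_skew C).
  move: (nab p _ _) (nab p _ _) (lie _ _ _) (Tv _ _ _) (Tv _ _ _) (Tv _ _ _).
  by move=> *; apply/rowP => i; rewrite !mxE; ring.
rewrite /curvature.
have := lie_jacobi C Vp sX sY sZ.
have := E X Y Z sX sY sZ; have := E Y Z X sY sZ sX; have := E Z X Y sZ sX sY.
have T1 := nab_torsion C Vp sX sY; have T2 := nab_torsion C Vp sY sZ.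
have T3 := nab_torsion C Vp sZ sX.
have T1' : Tv p (lie X Y p) (Z p) =
  Tv p (nab p (X p) Y) (Z p) - Tv p (nab p (Y p) X) (Z p) - Tv p (Tv p (X p) (Y p)) (Z p).
  by rewrite -TvB T1 TvD addrK.
have T2' : Tv p (lie Y Z p) (X p) =
  Tv p (nab p (Y p) Z) (X p) - Tv p (nab p (Z p) Y) (X p) - Tv p (Tv p (Y p) (Z p)) (X p).
  by rewrite -TvB T2 TvD addrK.
have T3' : Tv p (lie Z X p) (Y p) =
  Tv p (nab p (Z p) X) (Y p) - Tv p (nab p (X p) Z) (Y p) - Tv p (Tv p (Z p) (X p)) (Y p).
  by rewrite -TvB T3 TvD addrK.
rewrite (Tv_skew C p (lie Y Z p) (X p)) (Tv_skew C p (lie Z X p) (Y p)).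
rewrite (Tv_skew C p (lie X Y p) (Z p)) T1' T2' T3' => E1 E2 E3 J.
apply/rowP => i; move: E1 E2 E3 J => /rowP/(_ i) + /rowP/(_ i) + /rowP/(_ i) + /rowP/(_ i).
rewrite !mxE; move: (nab _ _ _ _ _) (nab _ _ _ _ _) (nab _ _ _ _ _) (nab _ _ _ _ _).
by move=> *; lra.
Qed.

(** The 4-form sigma_T without reference to a frame; the comparison is [sigmaTE]. *)
Definition torsion4 p u v w z : R :=
  g p (Tv p u v) (Tv p w z) + g p (Tv p v w) (Tv p u z) + g p (Tv p w u) (Tv p v z).

(** Unlike in [bianchi], the first argument stays fixed, because the Clifford contraction is
    performed with [X] fixed. This is the octahedron argument: the Bianchi identity for the four
    cyclic shifts, combined with skewness in each pair, without isolating the pair symmetry. *)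
Lemma curvature_cyclic X Y Z W p : V p -> SX X -> SX Y -> SX Z -> SX W ->
  g p (curvature X Y Z p) (W p) + g p (curvature X Z W p) (Y p)
  + g p (curvature X W Y p) (Z p) = torsion4 p (X p) (Y p) (Z p) (W p).
Proof.
move=> Vp sX sY sZ sW.
have gTv a b c d : g p (Tv p (Tv p a b) c) d = g p (Tv p a b) (Tv p c d).
  rewrite (Tv_skew C p c) -scaleN1r gZ mulN1r (Tv_metric_skew C)// opprK.
  exact: (inner_sym C).
have B X1 X2 X3 X4 : SX X1 -> SX X2 -> SX X3 -> SX X4 ->
    g p (curvature X1 X2 X3 p) (X4 p) + g p (curvature X2 X3 X1 p) (X4 p) +
    g p (curvature X3 X1 X2 p) (X4 p) = torsion4 p (X1 p) (X2 p) (X3 p) (X4 p).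
  by move=> s1 s2 s3 s4; rewrite -!gD bianchi// !gD !gTv.
have S12 X1 X2 X3 X4 : SX X1 -> SX X2 -> SX X3 -> SX X4 ->
    g p (curvature X2 X1 X3 p) (X4 p) = - g p (curvature X1 X2 X3 p) (X4 p).
  by move=> s1 s2 s3 s4; rewrite curvature_swap// -scaleN1r gZ mulN1r.
have S34 := curvature_skew Vp.
have gTN a b c d : g p (Tv p b a) (Tv p c d) = - g p (Tv p a b) (Tv p c d).
  by rewrite (Tv_skew C p a b) -scaleN1r gZ mulN1r.
have gTN2 a b c d : g p (Tv p a b) (Tv p d c) = - g p (Tv p a b) (Tv p c d).
  by rewrite ![g p (Tv p a b) _](inner_sym C) gTN.
(* A cyclic shift of four arguments is an odd permutation, hence the sign. *)
have TC a b c d : torsion4 p b c d a = - torsion4 p a b c d.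
  rewrite /torsion4 (gTN2 b c a d) (inner_sym C p (Tv p c d)) (gTN a b c d).
  rewrite (inner_sym C p (Tv p d b)) (gTN2 c a b d).
  by move: (g p _ _) (g p _ _) (g p _ _) => *; ring.
have E1 := B X Y Z W sX sY sZ sW.
have E2 := B Y Z W X sY sZ sW sX; have E3 := B Z W X Y sZ sW sX sY.
have E4 := B W X Y Z sW sX sY sZ.
rewrite TC in E2; rewrite TC TC opprK in E3; rewrite TC TC TC opprK in E4.
rewrite (S12 X W Y Z sX sW sY sZ) (S34 X Y W Z sX sY sW sZ) (S34 Y W X Z sY sW sX sZ) in E4.
rewrite (S12 X W Z Y sX sW sZ sY) (S34 X W Z Y sX sW sZ sY) in E3.
rewrite (S12 Z X W Y sZ sX sW sY) (S34 Z X W Y sZ sX sW sY) in E3.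
rewrite (S34 Y Z W X sY sZ sW sX) (S34 Z W Y X sZ sW sY sX) (S12 Y W Z X sY sW sZ sX) in E2.
rewrite (S12 Z X W Y sZ sX sW sY) (S34 Z X W Y sZ sX sW sY).
move: E1 E2 E3 E4; move: (torsion4 _ _ _ _ _) (g p (curvature X Y Z p) (W p)) => s a.
move: (g p (curvature Y Z X p) (W p)) (g p (curvature Z X Y p) (W p)) => b c.
move: (g p (curvature X W Y p) (Z p)) (g p (curvature Z W X p) (Y p)) => b' a'.
by move: (g p (curvature Y W Z p) (X p)) => c'; lra.
Qed.

Lemma curvature_lincomb3 X Y (I : finType) (h : I -> M -> R) (E : I -> M -> 'rV[R]_n) p :
  V p -> SX X -> SX Y -> (forall b, SF (h b)) -> (forall b, SX (E b)) ->
  SX (fun=> 0) ->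
  curvature X Y (fun q => \sum_b h b q *: E b q) p =
  \sum_b h b p *: curvature X Y (E b) p.
Proof.
move=> Vp sX sY sh sE s0.
suff H r : SX (fun q => \sum_(b <- r) h b q *: E b q) /\
    curvature X Y (fun q => \sum_(b <- r) h b q *: E b q) p =
    \sum_(b <- r) h b p *: curvature X Y (E b) p by have [] := H (index_enum I).
elim: r => [|b r [sr IH]].
  under eq_fun do rewrite big_nil; split=> //; rewrite big_nil.
  have := curvature_add3 Vp sX sY s0 s0.
  under eq_fun do rewrite addr0.
  by move=> /eqP; rewrite -subr_eq subrr eq_sym => /eqP.
under eq_fun do rewrite big_cons; split.
  by apply: (SX_add C) => //; exact: (SX_scale C).
by rewrite big_cons curvature_add3//; [rewrite curvature_scale3// IH|exact: (SX_scale C)].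
Qed.

(** Cartan's second structure equation, [om] being the connection forms. The quadratic part comes
    from metricity, by expanding inner products of covariant derivatives of the frame fields. *)
Lemma curvature_frame (f : 'I_n -> M -> 'rV[R]_n) X Y k l p :
  V p -> SX X -> SX Y -> (forall k, SX (f k)) ->
  (forall u v, g p u v = \sum_m g p u (f m p) * g p v (f m p)) ->
  let om (Z : M -> 'rV[R]_n) k l q := g q (nab q (Z q) (f k)) (f l q) in
  g p (curvature X Y (f k) p) (f l p) =
  dr p (X p) (om Y k l) - dr p (Y p) (om X k l) - g p (nab p (lie X Y p) (f k)) (f l p)
  + \sum_m (om X k m p * om Y l m p - om Y k m p * om X l m p).
Proof.
move=> Vp sX sY sf gf om.
rewrite sumrB -!gf (nab_metric C)//; last exact: (SX_nab C).
rewrite (nab_metric C)//; last exact: (SX_nab C).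
rewrite /curvature !gB.
by move: (g p _ _) (g p _ _) (g p _ _) (g p _ _) (g p _ _) => *; ring.
Qed.

End Curvature.

(** * Clifford algebra *)

Section CliffordAlgebra.
Context {K : numFieldType} {n N : nat} (gam : 'I_n -> 'M[K]_N)
  (gam_clifford : forall i j,
     gam i *m gam j + gam j *m gam i = (- ((i == j)%:R *+ 2))%:M).

Let q (i j : 'I_n) : K := - ((i == j)%:R *+ 2).

(** All pairs are summed, so an alternating [w] yields twice the Clifford action of the 2-form. *)
Definition quad (w : 'I_n -> 'I_n -> K) : 'M[K]_N :=
  \sum_b \sum_c w b c *: (gam b *m gam c).

(** Six times the Clifford action when [M] is alternating; also applied to coefficients that are
    skew in the last two slots only, such as those of the curvature. *)
Definition cubic (M : 'I_n -> 'I_n -> 'I_n -> K) : 'M[K]_N :=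
  \sum_l \sum_b \sum_c M l b c *: (gam l *m gam b *m gam c).

Let gamC i j : gam i *m gam j = (q i j)%:M - gam j *m gam i.
Proof. by rewrite /q -gam_clifford addrK. Qed.

Let qC i j : q i j = q j i.
Proof. by rewrite /q eq_sym. Qed.

Let sum_q (V : lmodType K) a (F : 'I_n -> V) : \sum_b q a b *: F b = - (F a *+ 2).
Proof.
rewrite (bigD1 a) //= big1 ?addr0 => [|b ba].
  by rewrite /q eqxx scaleNr -scalerMnl scale1r.
by rewrite /q eq_sym (negPf ba) mul0rn oppr0 scale0r.
Qed.

Lemma gam_sqr i : gam i *m gam i = - 1%:M.
Proof.
have := gam_clifford i i; rewrite eqxx -mulr2n => E.
apply: (@scalerI K _ 2%:R); first by rewrite pnatr_eq0.
by rewrite scaler_nat E scalerN scale_scalar_mx mulr1 raddfN.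
Qed.

Lemma sum3_rot (V : nmodType) (F : 'I_n -> 'I_n -> 'I_n -> V) :
  \sum_l \sum_b \sum_c F b c l = \sum_l \sum_b \sum_c F l b c.
Proof.
rewrite exchange_big /=; apply: eq_bigr => b _.
by rewrite exchange_big.
Qed.

Lemma sum3D (V : nmodType) (F G : 'I_n -> 'I_n -> 'I_n -> V) :
  \sum_l \sum_b \sum_c (F l b c + G l b c) =
  \sum_l \sum_b \sum_c F l b c + \sum_l \sum_b \sum_c G l b c.
Proof.
rewrite -big_split; apply: eq_bigr => l _; rewrite -big_split.
by apply: eq_bigr => b _; rewrite -big_split.
Qed.
Lemma sum3N (V : zmodType) (F : 'I_n -> 'I_n -> 'I_n -> V) :
  \sum_l \sum_b \sum_c (- F l b c) = - (\sum_l \sum_b \sum_c F l b c).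
Proof.
rewrite -sumrN; apply: eq_bigr => l _; rewrite -sumrN.
by apply: eq_bigr => b _; rewrite -sumrN.
Qed.

(** Bringing each triple product back to the order [l], [b], [c] costs anticommutators, each of
    which contracts two indices. Skewness in the last pair makes every contraction zero or a
    multiple of one trace; for curvature components this trace is the Ricci vector. *)
Lemma cubic_cyclic (M : 'I_n -> 'I_n -> 'I_n -> K) :
  (forall l b c, M l c b = - M l b c) ->
  cubic (fun l b c => M l b c + M b c l + M c l b) =
  cubic M *+ 3 + (\sum_l \sum_c M l l c *: gam c) *+ 6.
Proof.
move=> MC.
have P1 l b c : M l b c *: (gam c *m gam l *m gam b) =
    M l b c *: (gam l *m gam b *m gam c) +
    (q l c *: (M l b c *: gam b) - q b c *: (M l b c *: gam l)).
  rewrite (gamC c l) mulmxBl mul_scalar_mx -[gam l *m gam c *m _]mulmxA (gamC c b) mulmxBr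
    mul_mx_scalar.
  rewrite mulmxA opprB addrCA scalerDr scalerBr (qC c l) (qC c b).
  by rewrite !scalerA ![_ * M _ _ _]mulrC.
have P2 l b c : M l b c *: (gam b *m gam c *m gam l) =
    M l b c *: (gam l *m gam b *m gam c) +
    (q l c *: (M l b c *: gam b) - q l b *: (M l b c *: gam c)).
  rewrite -mulmxA (gamC c l) mulmxBr mul_mx_scalar mulmxA (gamC b l).
  rewrite mulmxBl mul_scalar_mx opprB addrCA scalerDr scalerBr (qC c l) (qC b l).
  by rewrite !scalerA ![_ * M _ _ _]mulrC.
have S1 : \sum_l \sum_b \sum_c q l c *: (M l b c *: gam b) =
    (\sum_l \sum_c M l l c *: gam c) *+ 2.
  rewrite -sumrMnl; apply: eq_bigr => l _; rewrite -sumrMnl; apply: eq_bigr => b _.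
  by rewrite sum_q MC scaleNr mulNrn opprK.
have S2 : \sum_l \sum_b \sum_c q b c *: (M l b c *: gam l) = 0.
  rewrite big1 // => l _; rewrite big1 // => b _; rewrite sum_q.
  have : M l b b *+ 2 == 0 by rewrite mulr2n {1}MC addNr.
  by rewrite mulrn_eq0 /= => /eqP->; rewrite scale0r mul0rn oppr0.
have S3 : \sum_l \sum_b \sum_c q l b *: (M l b c *: gam c) =
    - ((\sum_l \sum_c M l l c *: gam c) *+ 2).
  rewrite -sumrMnl -sumrN; apply: eq_bigr => l _.
  rewrite exchange_big -sumrMnl -sumrN; apply: eq_bigr => c _.
  by rewrite sum_q.
have E : cubic (fun l b c => M l b c + M b c l + M c l b) =
    cubic M + \sum_l \sum_b \sum_c M l b c *: (gam c *m gam l *m gam b) +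
    \sum_l \sum_b \sum_c M l b c *: (gam b *m gam c *m gam l).
  rewrite -(sum3_rot (fun l b c => M l b c *: (gam c *m gam l *m gam b))).
  rewrite [X in _ + X](sum3_rot (fun l b c => M c l b *: (gam l *m gam b *m gam c))).
  rewrite /cubic -!sum3D; apply: eq_bigr => l _; apply: eq_bigr => b _.
  by apply: eq_bigr => c _; rewrite !scalerDl.
rewrite E; under [X in _ + X + _]eq_bigr do under eq_bigr do under eq_bigr do rewrite P1.
under [X in _ + X]eq_bigr do under eq_bigr do under eq_bigr do rewrite P2.
rewrite !sum3D !sum3N S1 S2 S3 oppr0 addr0 opprK -/(cubic M).
move: (cubic M) (\sum_l _) => C D.
by apply/matrixP => i j; rewrite !(mulmxnE, mxE); ring.
Qed.

Definition vec (v : 'I_n -> K) : 'M[K]_N := \sum_l v l *: gam l.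

Lemma gam_vec (v : 'I_n -> K) b : gam b *m vec v = (- (v b *+ 2))%:M - vec v *m gam b.
Proof.
rewrite /vec mulmx_sumr mulmx_suml.
under eq_bigr do rewrite -scalemxAr gamC scalerBr.
rewrite sumrB; congr (_ - _); last by apply: eq_bigr => l _; rewrite scalemxAl.
under eq_bigr do rewrite scale_scalar_mx mulrC -scale_scalar_mx.
by rewrite sum_q raddfN; congr (- _); apply/matrixP => i j; rewrite !(mulmxnE, mxE) mulrnAC.
Qed.

(** The action of so(n) on vectors by commutators. Of the 4, one factor 2 comes from the
    anticommutator and one from the double sum. *)
Lemma quad_gam_comm (w : 'I_n -> 'I_n -> K) m : (forall k l, w l k = - w k l) ->
  quad w *m gam m - gam m *m quad w = vec (w m) *+ 4.
Proof.
move=> wC; have E k l : w k l *: (gam k *m gam l) *m gam m -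
    gam m *m (w k l *: (gam k *m gam l)) =
    q m l *: (w k l *: gam k) - q m k *: (w k l *: gam l).
  rewrite -scalemxAl -scalemxAr -scalerBr -mulmxA (gamC l m) mulmxBr mulmxA.
  rewrite (gamC k m) mulmxBl mul_mx_scalar mul_scalar_mx (qC l m) (qC k m) mulmxA.
  move: (gam m *m gam k *m gam l) => z.
  by apply/matrixP => i j; rewrite !(mulmxnE, mxE); ring.
rewrite /quad mulmx_suml mulmx_sumr -sumrB.
under eq_bigr do rewrite mulmx_suml mulmx_sumr -sumrB.
under eq_bigr do under eq_bigr do rewrite E.
under eq_bigr do rewrite sumrB sum_q.
rewrite sumrB [X in _ - X]exchange_big /=.
under [X in _ - X]eq_bigr do rewrite sum_q.
rewrite /vec -sumrB -sumrMnl; apply: eq_bigr => l _.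
rewrite wC; apply/matrixP => i j; rewrite !(mulmxnE, mxE); ring.
Qed.

(** Up to scale, [quad] is the spin representation of the Lie algebra so(n); this follows from
    [quad_gam_comm] by the Leibniz rule. It accounts for the quadratic part of the curvature. *)
Lemma quad_comm (al be : 'I_n -> 'I_n -> K) :
  (forall k l, al l k = - al k l) -> (forall k l, be l k = - be k l) ->
  quad al *m quad be - quad be *m quad al =
  quad (fun k l => \sum_m (al k m * be l m - be k m * al l m)) *+ 4.
Proof.
move=> alC beC.
have D k l : quad al *m (gam k *m gam l) - gam k *m gam l *m quad al =
   vec (al k) *m gam l *+ 4 + gam k *m vec (al l) *+ 4.
  rewrite -!(@scaler_nat _ 'M[K]_N) scalemxAl scalemxAr !scaler_nat -!quad_gam_comm//.
  rewrite mulmxBl mulmxBr !mulmxA.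
  by rewrite addrA subrK.
rewrite {2 4}/quad mulmx_sumr mulmx_suml -sumrB.
under eq_bigr do rewrite mulmx_sumr mulmx_suml -sumrB.
under eq_bigr do under eq_bigr do rewrite -scalemxAl -scalemxAr -scalerBr D scalerDr.
rewrite -[_ *+ 4]scaler_nat; under eq_bigr do under eq_bigr do
  rewrite -scalerDr -[_ *+ 4]scaler_nat -[X in _ + X]scaler_nat -scalerDr scalerA
    mulrC -scalerA scalerDr.
under eq_bigr do rewrite -scaler_sumr big_split /=.
rewrite -scaler_sumr big_split /=; congr (_ *: _).
have -> : quad (fun k l => \sum_m (al k m * be l m - be k m * al l m)) =
    \sum_k \sum_l \sum_m (al k m * be l m) *: (gam k *m gam l) -
    \sum_k \sum_l \sum_m (be k m * al l m) *: (gam k *m gam l).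
  rewrite -sum3N -sum3D; apply: eq_bigr => k _; apply: eq_bigr => l _.
  by rewrite scaler_suml; apply: eq_bigr => m _; rewrite scalerBl.
congr (_ + _).
  rewrite -sum3_rot; apply: eq_bigr => k _; rewrite exchange_big /=.
  apply: eq_bigr => l _; rewrite /vec mulmx_suml scaler_sumr; apply: eq_bigr => m _.
  by rewrite -scalemxAl scalerA alC beC mulrNN mulrC.
rewrite -sum3N; apply: eq_bigr => k _; rewrite [RHS]exchange_big /=.
apply: eq_bigr => l _.
rewrite /vec mulmx_sumr scaler_sumr; apply: eq_bigr => m _.
by rewrite -scalemxAr scalerA alC mulrN scaleNr.
Qed.

(** In terms of forms, [X T + T X = - 2 X _| T], with [cubic] counting [T] six times and [quad]
    counting [X _| T] twice. *)
Lemma gam_cubic (t : 'I_n -> 'I_n -> 'I_n -> K) x :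
  (forall a b c, t b a c = - t a b c) -> (forall a b c, t a c b = - t a b c) ->
  gam x *m cubic t + cubic t *m gam x = - (quad (t x) *+ 6).
Proof.
move=> t12 t23.
have E a b c : gam x *m (t a b c *: (gam a *m gam b *m gam c)) +
    t a b c *: (gam a *m gam b *m gam c) *m gam x =
    q x c *: (t a b c *: (gam a *m gam b)) - q x b *: (t a b c *: (gam a *m gam c)) +
    q x a *: (t a b c *: (gam b *m gam c)).
  rewrite -scalemxAl -scalemxAr -scalerDr -[_ *m gam x]mulmxA (gamC c x) mulmxBr !mulmxA.
  rewrite -[gam a *m gam b *m gam x]mulmxA (gamC b x) mulmxBr mulmxBl mulmxA (gamC a x).
  rewrite !mulmxBl !mul_mx_scalar -!scalemxAl !mul_scalar_mx -!scalemxAl !(qC _ x).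
  rewrite !scalerA ![_ * t _ _ _]mulrC -!scalerA -scalerBr -scalerDr; congr (_ *: _).
  move: (gam a *m gam b) (gam a *m gam c) (gam b *m gam c) => u v w.
  move: (_ *m _ *m _ *m _) => z.
  by apply/matrixP => i j; rewrite !(mulmxnE, mxE); ring.
rewrite /cubic mulmx_sumr mulmx_suml -big_split /=.
under eq_bigr do rewrite mulmx_sumr mulmx_suml -big_split /=.
under eq_bigr do under eq_bigr do rewrite mulmx_sumr mulmx_suml -big_split /=.
under eq_bigr do under eq_bigr do under eq_bigr do rewrite E.
rewrite !sum3D sum3N.
have sum_quad (w : 'I_n -> 'I_n -> 'I_n -> K) (h : K) :
    (forall l b, w l b x = h * t x l b) ->
    \sum_l \sum_b \sum_c q x c *: (w l b c *: (gam l *m gam b)) =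
    - (h *: quad (t x) *+ 2).
  move=> wt; rewrite /quad scaler_sumr -sumrMnl -sumrN; apply: eq_bigr => l _.
  rewrite scaler_sumr -sumrMnl -sumrN; apply: eq_bigr => b _.
  by rewrite sum_q wt scalerA.
have -> := @sum_quad t 1; last by move=> l b; rewrite mul1r t23 t12 opprK.
have -> : \sum_l \sum_b \sum_c q x b *: (t l b c *: (gam l *m gam c)) =
    - (-1 *: quad (t x) *+ 2).
  rewrite -(@sum_quad (fun l c b => t l b c)).
    by apply: eq_bigr => l _; rewrite exchange_big.
  by move=> l b; rewrite t12 mulN1r.
have -> : \sum_l \sum_b \sum_c q x l *: (t l b c *: (gam b *m gam c)) =
    - (1 *: quad (t x) *+ 2).
  by rewrite -sum3_rot -sum3_rot -(@sum_quad (fun b c l => t l b c)) // => l b; rewrite mul1r.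
by apply/matrixP => i j; rewrite !(mulmxnE, mxE); ring.
Qed.

(** The components of sigma_T in the frame: the half in its definition merges the equal terms of
    each wedge square. *)
Definition four_form (t : 'I_n -> 'I_n -> 'I_n -> K) (x l b c : 'I_n) : K :=
  \sum_a (t a x l * t a b c - t a x b * t a l c + t a x c * t a l b).

(** The commutator with [quad (t x)] is a derivation: it replaces one factor of each triple product
    by a vector. Moving that vector to the front leaves contractions, which are exactly the trace
    terms of [cubic_cyclic]. *)
Lemma cubic_quad_comm (t : 'I_n -> 'I_n -> 'I_n -> K) x :
  (forall a b c, t b a c = - t a b c) -> (forall a b c, t a c b = - t a b c) ->
  cubic t *m quad (t x) - quad (t x) *m cubic t = cubic (four_form t x) *+ 4.
Proof.
move=> t12 t23.
have txC k l : t x l k = - t x k l by exact: t23.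
pose v a := vec (t x a).
have D a b c : quad (t x) *m (gam a *m gam b *m gam c) -
    gam a *m gam b *m gam c *m quad (t x) =
    (v a *m gam b *m gam c + gam a *m v b *m gam c + gam a *m gam b *m v c) *+ 4.
  have Nl (y z : 'M[K]_N) : (y *m z) *+ 4 = (y *+ 4) *m z.
    by rewrite -!(@scaler_nat _ 'M[K]_N) scalemxAl.
  have Nr (y z : 'M[K]_N) : (y *m z) *+ 4 = y *m (z *+ 4).
    by rewrite -!(@scaler_nat _ 'M[K]_N) scalemxAr.
  rewrite !mulrnDl Nl Nl (Nl (gam a *m v b)) (Nr (gam a)) (Nr _ (v c)).
  rewrite -!quad_gam_comm// !(mulmxBl, mulmxBr) !mulmxA.
  by rewrite !subrKA.
(* [P] has the new vector in first position; [L] collects the contractions produced by moving it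
   there. *)
pose P := \sum_a \sum_b \sum_c t a b c *: (v a *m gam b *m gam c).
pose L := \sum_a \sum_b \sum_c t a b c *: (t x a b *: gam c).
have P2 : \sum_a \sum_b \sum_c t a b c *: (gam a *m v b *m gam c) = P + L *+ 2.
  rewrite exchange_big -sumrMnl /P /L -big_split /=; apply: eq_bigr => a _.
  rewrite -sumrMnl -big_split; apply: eq_bigr => b _.
  rewrite -sumrMnl -big_split; apply: eq_bigr => c _ /=.
  rewrite (gam_vec (t x a) b) mulmxBl mul_scalar_mx t12.
  move: (v a *m gam b *m gam c) => z; rewrite /v.
  by apply/matrixP => i j; rewrite !(mulmxnE, mxE); ring.
have P3 : \sum_a \sum_b \sum_c t a b c *: (gam a *m gam b *m v c) = P + L *+ 4.
  have LC : L = - \sum_a \sum_b \sum_c t a b c *: (t x a c *: gam b).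
    rewrite -sum3N; apply: eq_bigr => a _; rewrite exchange_big /=.
    by apply: eq_bigr => b _; apply: eq_bigr => c _; rewrite t23 scaleNr.
  rewrite -[L *+ 4]/(L *+ (2 + 2)) mulrnDr {2}LC -sum3_rot /P /L.
  rewrite mulNrn -!sumrMnl -sumrN -!big_split /=; apply: eq_bigr => a _.
  rewrite -!sumrMnl -sumrN -!big_split /=; apply: eq_bigr => b _.
  rewrite -!sumrMnl -sumrN -!big_split /=; apply: eq_bigr => c _.
  rewrite -mulmxA (gam_vec (t x a) c) mulmxBr mulmxA (gam_vec (t x a) b).
  rewrite mulmxBl mul_mx_scalar mul_scalar_mx t23 t12 opprK.
  move: (v a *m gam b *m gam c) => z; rewrite /v.
  by apply/matrixP => i j; rewrite !(mulmxnE, mxE); ring.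
(* [M] contracts two copies of the 3-form. Its trace gives [L], and its cyclic sum is minus
   [four_form]. *)
pose M l b c := \sum_a t a b c * t x a l.
have MC l b c : M l c b = - M l b c.
  by rewrite /M -sumrN; apply: eq_bigr => a _; rewrite t23 mulNr.
have PM : P = cubic M.
  rewrite /P [LHS]exchange_big /cubic -[RHS]sum3_rot -[RHS]sum3_rot /=.
  apply: eq_bigr => b _; rewrite [LHS]exchange_big; apply: eq_bigr => c _ /=.
  under [RHS]eq_bigr do rewrite scaler_suml.
  rewrite [RHS]exchange_big; apply: eq_bigr => a _ /=.
  rewrite /v /vec !mulmx_suml scaler_sumr; apply: eq_bigr => l _.
  by rewrite -!scalemxAl scalerA.
have LM : L = \sum_l \sum_c M l l c *: gam c.
  rewrite /L exchange_big /=; apply: eq_bigr => b _; rewrite exchange_big /=.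
  apply: eq_bigr => c _; rewrite /M scaler_suml; apply: eq_bigr => a _.
  by rewrite scalerA.
have FM : cubic (four_form t x) = - cubic (fun l b c => M l b c + M b c l + M c l b).
  rewrite /cubic -sum3N; apply: eq_bigr => l _; apply: eq_bigr => b _.
  apply: eq_bigr => c _; rewrite -scaleNr; congr (_ *: _).
  rewrite /M /four_form -!big_split -sumrN; apply: eq_bigr => a _ /=.
  by rewrite !(t12 x a) (t23 a l c); ring.
have TT : quad (t x) *m cubic t - cubic t *m quad (t x) =
    (P + (P + L *+ 2) + (P + L *+ 4)) *+ 4.
  rewrite -P2 -P3 /P -!sum3D -scaler_nat !scaler_sumr /cubic mulmx_sumr mulmx_suml -sumrB.
  apply: eq_bigr => a _; rewrite scaler_sumr mulmx_sumr mulmx_suml -sumrB.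
  apply: eq_bigr => b _; rewrite scaler_sumr mulmx_sumr mulmx_suml -sumrB.
  apply: eq_bigr => c _; rewrite -scalemxAl -scalemxAr -scalerBr D.
  by rewrite -[_ *+ 4]scaler_nat !scalerDr !scalerA [4 * _]mulrC.
rewrite -[LHS]opprB TT FM cubic_cyclic// -PM -LM.
by apply/matrixP => i j; rewrite !(mulmxnE, mxE); ring.
Qed.

(** * Clifford contractions applied to a fixed spinor *)

Section ParallelSpinor.
Context {m : nat} (phi : 'M[K]_(N, m)).

(** [cubic t] acts by a scalar on [phi], by contracting the hypothesis, and by another one on
    [gam x *m phi], by [gam_cubic]. Evaluating [cubic_quad_comm] on [phi] with these two scalars
    produces the factor [n - 3]. *)
Lemma cubic_four_form_eigen (t : 'I_n -> 'I_n -> 'I_n -> K) (mu : K) x :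
  (forall a b c, t b a c = - t a b c) -> (forall a b c, t a c b = - t a b c) ->
  (forall y, quad (t y) *m phi = (2 * mu) *: (gam y *m phi)) ->
  cubic (four_form t x) *m phi = (2 * (n%:R - 3) * mu ^+ 2) *: (gam x *m phi).
Proof.
move=> t12 t23 H.
have tau : cubic t *m phi = - (2 * n%:R * mu) *: phi.
  transitivity (\sum_(l < n) gam l *m (quad (t l) *m phi)).
    rewrite /cubic /quad mulmx_suml; apply: eq_bigr => l _.
    rewrite mulmxA mulmx_sumr !mulmx_suml; apply: eq_bigr => b _.
    rewrite mulmx_sumr !mulmx_suml; apply: eq_bigr => c _.
    by rewrite -scalemxAr !mulmxA.
  under eq_bigr do rewrite H -scalemxAr mulmxA gam_sqr mulNmx mul1mx scalerN -scaleNr.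
  by rewrite sumr_const card_ord scalerMnl -mulr_natr; congr (_ *: _); ring.
have tauX : cubic t *m (gam x *m phi) =
    (2 * n%:R * mu - 12 * mu) *: (gam x *m phi).
  have := congr1 (fun z => z *m phi) (gam_cubic x t12 t23).
  rewrite /= mulmxDl -!mulmxA tau mulNmx -[quad _ *+ 6]scaler_nat -scalemxAl H -scalemxAr scalerA.
  move=> /(canRL (addKr _)) ->.
  by apply/matrixP => i j; rewrite !mxE; ring.
have := congr1 (fun z => z *m phi) (cubic_quad_comm x t12 t23).
rewrite /= mulmxBl -!mulmxA H tau -!scalemxAr H tauX -[_ *+ 4]scaler_nat -scalemxAl.
move=> E; apply: (@scalerI K _ 4); first by rewrite pnatr_eq0.
by rewrite -E; apply/matrixP => i j; rewrite !mxE; ring.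
Qed.

(** [cubic r] is the sum of the [gam l *m quad (r l)], so it kills [phi], and only the trace
    survives in [cubic_cyclic]. *)
Lemma ricci_contraction (r : 'I_n -> 'I_n -> 'I_n -> K)
    (w : 'I_n -> 'I_n -> 'I_n -> K) :
  (forall j k l, r j l k = - r j k l) ->
  (forall j k l, r j k l + r k l j + r l j k = w j k l) ->
  (forall j, quad (r j) *m phi = 0) ->
  6 *: (vec (fun l => \sum_j r j j l) *m phi) = cubic w *m phi.
Proof.
move=> rC rw r0.
have c0 : cubic r *m phi = 0.
  rewrite /cubic mulmx_suml big1 // => l _; rewrite -[RHS](mulmx0 _ (gam l)) -(r0 l).
  rewrite /quad mulmxA mulmx_sumr !mulmx_suml; apply: eq_bigr => b _.
  rewrite mulmx_sumr !mulmx_suml; apply: eq_bigr => c _.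
  by rewrite -scalemxAr !mulmxA.
have -> : cubic w = cubic (fun l b c => r l b c + r b c l + r c l b).
  by apply: eq_bigr => l _; apply: eq_bigr => b _; apply: eq_bigr => c _; rewrite rw.
rewrite cubic_cyclic// mulmxDl -[cubic r *+ 3]scaler_nat -scalemxAl c0 scaler0 add0r.
rewrite -[(\sum_l _) *+ 6]scaler_nat -scalemxAl; congr (_ *: (_ *m _)).
rewrite exchange_big; apply: eq_bigr => l _ /=.
by rewrite scaler_suml.
Qed.

End ParallelSpinor.

(** * From increasing to full sums, and change of frame *)

Section IncreasingIndices.
Context {V : nmodType}.

Lemma sum2_increasing (G : 'I_n -> 'I_n -> V) :
  (forall k l, G l k = G k l) -> (forall k, G k k = 0) ->
  \sum_k \sum_l G k l = (\sum_(k < n) \sum_(l < n | (k < l)%N) G k l) *+ 2.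
Proof.
move=> GC G0.
have -> : \sum_k \sum_l G k l =
    \sum_(k < n) \sum_(l < n) (if (k < l)%N then G k l else 0) +
    \sum_(k < n) \sum_(l < n) (if (l < k)%N then G k l else 0).
  rewrite -big_split; apply: eq_bigr => k _; rewrite -big_split.
  apply: eq_bigr => l _ /=; case: ltngtP => [||/val_inj ->]; rewrite ?addr0 ?add0r//.
rewrite [X in _ + X]exchange_big mulr2n; congr (_ + _).
  by apply: eq_bigr => k _; rewrite [RHS]big_mkcond.
by apply: eq_bigr => k _; rewrite [RHS]big_mkcond; apply: eq_bigr => l _; rewrite GC.
Qed.

Lemma sum3_increasing (F : 'I_n -> 'I_n -> 'I_n -> V) :
  (forall i j k, F j i k = F i j k) -> (forall i j k, F i k j = F i j k) ->
  (forall i k, F i i k = 0) ->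
  \sum_i \sum_j \sum_k F i j k =
  (\sum_(i < n) \sum_(j < n | (i < j)%N) \sum_(k < n | (j < k)%N) F i j k) *+ 6.
Proof.
move=> F12 F23 F0.
(* [H] restricts [F] to increasing triples; a triple of distinct indices is seen by exactly one of
   the six permuted copies of [H]. *)
pose H (i j k : 'I_n) := if (i < j)%N && (j < k)%N then F i j k else 0.
have S12 (G : 'I_n -> 'I_n -> 'I_n -> V) :
  \sum_i \sum_j \sum_k G j i k = \sum_i \sum_j \sum_k G i j k by exact: exchange_big.
have S23 (G : 'I_n -> 'I_n -> 'I_n -> V) :
  \sum_i \sum_j \sum_k G i k j = \sum_i \sum_j \sum_k G i j k.
  by apply: eq_bigr => i _; exact: exchange_big.
have -> : \sum_(i < n) \sum_(j < n | (i < j)%N) \sum_(k < n | (j < k)%N) F i j k =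
    \sum_i \sum_j \sum_k H i j k.
  apply: eq_bigr => i _; rewrite big_mkcond; apply: eq_bigr => j _.
  rewrite /H; case: (i < j)%N => /=; last by rewrite big1.
  by rewrite big_mkcond.
have -> : \sum_i \sum_j \sum_k F i j k = \sum_i \sum_j \sum_k
    (H i j k + H i k j + H j i k + (H j k i + H k i j + H k j i)).
  apply: eq_bigr => i _; apply: eq_bigr => j _; apply: eq_bigr => k _.
  have E1 : F i k j = F i j k by []. have E2 : F j i k = F i j k by [].
  have E3 : F j k i = F i j k by rewrite F23.
  have E4 : F k i j = F i j k by rewrite F12.
  have E5 : F k j i = F i j k by rewrite F23 F12.
  have Z : (i == j) || (j == k) || (i == k) -> F i j k = 0.
    case/orP => [/orP[]|] /eqP; first by move->.
      by move->; rewrite F12 F23.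
    by move->; rewrite F23.
  rewrite /H E1 E2 E3 E4 E5 -!val_eqE /= in Z *.
  move: Z; move: (F i j k) => z.
  by case: (ltngtP i j); case: (ltngtP j k); case: (ltngtP i k) => /= ik jk ij Z;
    first [by rewrite ?addr0 ?add0r | by rewrite (Z isT) ?addr0
          | exfalso; move: ij jk ik; clear; lia].
rewrite !sum3D.
have S312 : \sum_i \sum_j \sum_k H k i j = \sum_i \sum_j \sum_k H i j k.
  exact: (esym (sum3_rot (fun x y z => H z x y))).
rewrite (S23 H) (S12 H) (sum3_rot H) (S12 (fun i j k => H k i j)) S312.
by rewrite !mulrS mulr0n addr0 !addrA.
Qed.

End IncreasingIndices.

Lemma quad_increasing (w : 'I_n -> 'I_n -> K) : (forall k l, w l k = - w k l) ->
  quad w = (\sum_(k < n) \sum_(l < n | (k < l)%N) w k l *: (gam k *m gam l)) *+ 2.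
Proof.
move=> wC; have w0 k : w k k = 0.
  have : w k k *+ 2 == 0 by rewrite mulr2n {1}wC addNr.
  by rewrite mulrn_eq0 /= => /eqP.
apply: sum2_increasing => [k l|k]; last by rewrite w0 scale0r.
have [->//|kl] := eqVneq k l.
by rewrite wC gamC /q eq_sym (negPf kl) mul0rn oppr0 raddf0 sub0r scalerN scaleNr opprK.
Qed.

(** Bilinear expansion of both factors, which is available because the sums run over all indices. *)
Lemma quad_frame_change (gam' : 'I_n -> 'M[K]_N) (P : 'I_n -> 'I_n -> K)
    (w w' : 'I_n -> 'I_n -> K) :
  (forall b, gam' b = vec (P b)) ->
  (forall k l, w k l = \sum_b \sum_c w' b c * P b k * P c l) ->
  \sum_b \sum_c w' b c *: (gam' b *m gam' c) = quad w.
Proof.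
move=> gE wE; rewrite /quad.
under [RHS]eq_bigr do under eq_bigr do rewrite wE scaler_suml.
under [RHS]eq_bigr do rewrite exchange_big.
rewrite [RHS]exchange_big; apply: eq_bigr => b _ /=.
under [RHS]eq_bigr do under eq_bigr do rewrite scaler_suml.
under [RHS]eq_bigr do rewrite exchange_big.
rewrite [RHS]exchange_big; apply: eq_bigr => c _ /=.
rewrite !gE /vec mulmx_suml scaler_sumr; apply: eq_bigr => k _.
rewrite mulmx_sumr scaler_sumr; apply: eq_bigr => l _.
by rewrite -scalemxAl -scalemxAr !scalerA.
Qed.

Lemma cubic_increasing (w : 'I_n -> 'I_n -> 'I_n -> K) :
  (forall i j k, w j i k = - w i j k) -> (forall i j k, w i k j = - w i j k) ->
  cubic w = (\sum_(i < n) \sum_(j < n | (i < j)%N) \sum_(k < n | (j < k)%N)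
               w i j k *: (gam i *m gam j *m gam k)) *+ 6.
Proof.
move=> w12 w23; have w0 i k : w i i k = 0.
  have : w i i k *+ 2 == 0 by rewrite mulr2n {1}w12 addNr.
  by rewrite mulrn_eq0 /= => /eqP.
have gamN i j : i != j -> gam i *m gam j = - (gam j *m gam i).
  by move=> ij; rewrite gamC /q (negPf ij) mul0rn oppr0 raddf0 sub0r.
apply: sum3_increasing => [i j k|i j k|i k]; last by rewrite w0 scale0r.
  have [->//|ij] := eqVneq i j.
  by rewrite w12 (gamN j i) 1?eq_sym// mulNmx scalerN scaleNr opprK.
have [->//|jk] := eqVneq j k.
by rewrite w23 -!mulmxA (gamN k j) 1?eq_sym// mulmxN scalerN scaleNr opprK.
Qed.

Lemma cubic_frame_change (gam' : 'I_n -> 'M[K]_N) (P : 'I_n -> 'I_n -> K)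
    (w w' : 'I_n -> 'I_n -> 'I_n -> K) :
  (forall b, gam' b = vec (P b)) ->
  (forall i j k, w i j k = \sum_a \sum_b \sum_c w' a b c * P a i * P b j * P c k) ->
  \sum_a \sum_b \sum_c w' a b c *: (gam' a *m gam' b *m gam' c) = cubic w.
Proof.
move=> gE wE; rewrite /cubic.
(* The first index is changed alone; with it fixed, the other two are handled by
   [quad_frame_change]. *)
transitivity (\sum_i \sum_b \sum_c (\sum_a w' a b c * P a i) *: (gam i *m gam' b *m gam' c)).
  rewrite [RHS]exchange_big /=; under [RHS]eq_bigr do rewrite exchange_big.
  rewrite [LHS]exchange_big; apply: eq_bigr => b _ /=.
  rewrite [LHS]exchange_big; apply: eq_bigr => c _ /=.
  under [RHS]eq_bigr do rewrite scaler_suml.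
  rewrite [RHS]exchange_big; apply: eq_bigr => a _ /=.
  rewrite (gE a) /vec !mulmx_suml scaler_sumr; apply: eq_bigr => i _.
  by rewrite -!scalemxAl scalerA.
apply: eq_bigr => i _.
have H := @quad_frame_change gam' P (fun j k => w i j k)
  (fun b c => \sum_a w' a b c * P a i) gE.
transitivity (gam i *m quad (fun j k => w i j k)).
  rewrite -H.
    rewrite mulmx_sumr; apply: eq_bigr => b _; rewrite mulmx_sumr.
    by apply: eq_bigr => c _; rewrite -scalemxAr mulmxA.
  move=> j k; rewrite wE exchange_big; apply: eq_bigr => b _ /=.
  rewrite exchange_big; apply: eq_bigr => c _ /=.
  by rewrite mulr_suml mulr_suml.
rewrite /quad mulmx_sumr; apply: eq_bigr => b _; rewrite mulmx_sumr.
by apply: eq_bigr => c _; rewrite -scalemxAr mulmxA.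
Qed.

End CliffordAlgebra.

(** * The connection with torsion of a Riemannian manifold *)

Section Metric.
Context {R : realType} {n : nat} {M : topologicalType} {A : smooth_atlas R n M}
  {g : M -> 'M[R]_n} (g_metric : is_metric A g).
Implicit Types (p : M) (u v w : 'rV[R]_n).

Lemma ip_linear p a u v w : ip g p (a *: u + v) w = a * ip g p u w + ip g p v w.
Proof. by rewrite /ip !mulmxDl -!scalemxAl !mxE. Qed.

Lemma ip_sym p u v : ip g p u v = ip g p v u.
Proof.
have [gT _ _] := g_metric; rewrite /ip -[RHS](mxE trmx_key (fun i j => (v *m g p *m u^T) j i)).
by rewrite -/(trmx _) !trmx_mul gT trmxK mulmxA.
Qed.

Lemma metric_unit p : g p \in unitmx.
Proof.
have [_ gpos _] := g_metric; rewrite -row_free_unit -kermx_eq0; apply/eqP/row_matrixP => i.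
rewrite row0; apply/eqP; apply: contraT => /(gpos p); rewrite /ip.
have /sub_kermxP -> : (row i (kermx (g p)) <= kermx (g p))%MS by exact: row_sub.
by rewrite mul0mx mxE ltxx.
Qed.

(** Orthonormality says [E g E^T = 1]; a one-sided inverse of a square matrix is two-sided, so
    [g E^T E = 1], which is the expansion. *)
Lemma orthonormal_expansion p (e : 'I_n -> 'rV[R]_n) v :
  (forall i j, ip g p (e i) (e j) = (i == j)%:R) ->
  v = \sum_k ip g p v (e k) *: e k.
Proof.
move=> eo; pose E := \matrix_(i, j) e i 0 j.
have gE u j : (u *m (g p *m E^T)) 0 j = ip g p u (e j).
  rewrite /ip -mulmxA !mxE; apply: eq_bigr => a _; rewrite !mxE; congr (_ * _).
  by apply: eq_bigr => b _; rewrite !mxE.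
have H : E *m (g p *m E^T) = 1%:M.
  apply/matrixP => i j; rewrite [RHS]mxE -eo -gE !mxE.
  by apply: eq_bigr => a _; rewrite !mxE.
rewrite -[LHS]mulmx1 -(mulmx1C H) mulmxA.
apply/rowP => j; rewrite mxE summxE; apply: eq_bigr => k _.
by rewrite gE !mxE.
Qed.

Lemma ip_orthonormal_sum p (e : 'I_n -> 'rV[R]_n) u v :
  (forall i j, ip g p (e i) (e j) = (i == j)%:R) ->
  ip g p u v = \sum_k ip g p u (e k) * ip g p v (e k).
Proof.
move=> eo; rewrite {1}(orthonormal_expansion u eo).
rewrite /ip mulmx_suml mulmx_suml summxE; apply: eq_bigr => k _.
by rewrite -!scalemxAl mxE; congr (_ * _); exact: ip_sym.
Qed.

Lemma linear_form_sum (h : 'rV[R]_n -> R) (I : finType) (c : I -> R)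
    (F : I -> 'rV[R]_n) :
  (forall b u v, h (b *: u + v) = b * h u + h v) ->
  h (\sum_k c k *: F k) = \sum_k c k * h (F k).
Proof.
move=> hl; have h0 : h 0 = 0 by have := hl 1 0 0; rewrite scaler0 addr0 mul1r; lra.
by apply: (big_rec2 (fun x y => h x = y)) => // k x y _ <-; exact: hl.
Qed.

(** * The torsion 3-form and its vector-valued version *)

Section Torsion.
Context {T : M -> 'rV[R]_n -> 'rV[R]_n -> 'rV[R]_n -> R} (T_3form : is_3form A T).

Lemma form_linear1 p a u u' v w : T p (a *: u + u') v w = a * T p u v w + T p u' v w.
Proof. by have [H _ _ _] := T_3form. Qed.

Lemma form_skew12 p u v w : T p v u w = - T p u v w.
Proof. by have [_ H _ _] := T_3form. Qed.

Lemma form_skew23 p u v w : T p u w v = - T p u v w.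
Proof. by have [_ _ H _] := T_3form. Qed.

Lemma form_linear2 p a u u' v w : T p v (a *: u + u') w = a * T p v u w + T p v u' w.
Proof.
by rewrite form_skew12 form_linear1 (form_skew12 p v u) (form_skew12 p v u'); ring.
Qed.

Lemma form_linear3 p a u u' v w : T p v w (a *: u + u') = a * T p v w u + T p v w u'.
Proof.
by rewrite form_skew23 form_linear2 (form_skew23 p v w u) (form_skew23 p v w u'); ring.
Qed.

Lemma form_sum3 p u v (I : finType) (c : I -> R) (w : I -> 'rV[R]_n) :
  T p u v (\sum_k c k *: w k) = \sum_k c k * T p u v (w k).
Proof. by apply: linear_form_sum => b x y; exact: form_linear3. Qed.

Lemma ip_Tvec p u v w : ip g p (Tvec g T p u v) w = T p u v w.
Proof.
rewrite /ip /Tvec mulmxKV ?metric_unit// [in RHS](row_sum_delta w) form_sum3.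
by rewrite mxE; apply: eq_bigr => k _; rewrite !mxE mulrC.
Qed.

Lemma Tvec_linear p a u v w :
  Tvec g T p (a *: u + v) w = a *: Tvec g T p u w + Tvec g T p v w.
Proof.
rewrite /Tvec scalemxAl -mulmxDl; congr (_ *m _).
by apply/rowP => j; rewrite !mxE form_linear1.
Qed.

Lemma Tvec_skew p u v : Tvec g T p v u = - Tvec g T p u v.
Proof.
by rewrite /Tvec -mulNmx; congr (_ *m _); apply/rowP => j; rewrite !mxE form_skew12.
Qed.

End Torsion.

(** * The connection with torsion as a model of the abstract calculus *)

Section SkewTorsion.
Context {nabg : M -> 'rV[R]_n -> (M -> 'rV[R]_n) -> 'rV[R]_n}
  (nabg_levi_civita : is_levi_civita A g nabg)
  {T : M -> 'rV[R]_n -> 'rV[R]_n -> 'rV[R]_n -> R} (T_3form : is_3form A T)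
  (T_parallel : parallel_3form A (conn g T nabg (1 / 4)) T)
  {V : set M} (Vo : open V) {e : 'I_n -> M -> 'rV[R]_n}
  (e_smooth : forall i, smooth_vf A V (e i))
  (e_orthonormal : forall p i j, V p -> ip g p (e i p) (e j p) = (i == j)%:R).
Implicit Types (X Y Z : M -> 'rV[R]_n).
Opaque smooth_fun smooth_vf dr dd lie.

Let nabc := conn g T nabg (1 / 4).

Let nabcE p v X : nabc p v X = nabg p v X + 2^-1 *: Tvec g T p v (X p).
Proof.
rewrite /nabc /conn; congr (_ + _ *: _).
by rewrite div1r -[4]/((2 * 2)%:R) natrM invfM mulrA divff ?mul1r// pnatr_eq0.
Qed.

(* Multiplying a field by the indicator function of [V] does not change it on
   [V], so the Leibniz rule makes a connection local. *)
Lemma connection_local p v X Y : V p -> smooth_vf A V X -> smooth_vf A V Y ->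
  {in V, X =1 Y} -> nabg p v X = nabg p v Y.
Proof.
move=> Vp sX sY XY; pose chi q : R := if q \in V then 1 else 0.
have schi : smooth_fun A V chi.
  apply: (smooth_fun_congr Vo _ (@smooth_fun_cst _ _ _ A V 1)) => q.
  by rewrite /chi => ->.
have E Z : smooth_vf A V Z -> nabg p v (fun q => chi q *: Z q) = nabg p v Z.
  move=> sZ; have [/(_ V Z Vo sZ)[_ _ /(_ p v chi Vp schi) -> _] _] := nabg_levi_civita.
  have -> : dd A p v chi = 0.
    rewrite -[LHS]/(dr A p v chi) -(dr_cst A p v 1).
    by apply: (@dr_congr _ _ _ A V) => // q; rewrite /chi => ->.
  by rewrite scale0r add0r /chi mem_set// scale1r.
rewrite -(E X sX) -(E Y sY); congr (nabg p v); apply/funext => q.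
by rewrite /chi; case: ifP => [/XY ->//|]; rewrite !scale0r.
Qed.

(** [Tvec] inverts the matrix [g p] in a chart that varies with the point, so smoothness is obtained
    from the expansion in a smooth orthonormal frame. *)
Lemma smooth_Tvec X Y : smooth_vf A V X -> smooth_vf A V Y ->
  smooth_vf A V (fun q => Tvec g T q (X q) (Y q)).
Proof.
move=> sX sY.
have E : {in V, (fun q => \sum_k T q (X q) (Y q) (e k q) *: e k q) =1
    (fun q => Tvec g T q (X q) (Y q))}.
  move=> q; rewrite inE => Vq.
  rewrite [RHS](orthonormal_expansion _ (fun i j => e_orthonormal i j Vq)).
  by apply: eq_bigr => k _; rewrite (ip_Tvec T_3form).
apply: (smooth_vf_congr Vo E); apply: (smooth_vf_sum Vo) => k.
apply: (smooth_vfZ Vo _ (e_smooth k)).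
by have [_ _ _ H] := T_3form; exact: (H V X Y (e k) Vo sX sY (e_smooth k)).
Qed.

(** Total skewness of [T] keeps the modified connection metric, and torsion-freeness of [nabg] makes
    [Tvec] its torsion. *)
Lemma skew_torsion_calculus_of_metric :
  skew_torsion_calculus V (smooth_fun A V) (smooth_vf A V) (dr A) (lie A) nabc
    (ip g) (Tvec g T).
Proof.
have [conng LC] := nabg_levi_civita.
have Tl := Tvec_linear T_3form; have Ts := Tvec_skew T_3form.
(* The torsion of [nabg + 1/2 T] is the antisymmetrisation of [1/2 T], hence [T] itself. *)
have half_skew p u v : 2^-1 *: Tvec g T p u v - 2^-1 *: Tvec g T p v u = Tvec g T p u v.
  rewrite (Ts p u v) scalerN opprK -scalerDl.
  by rewrite (_ : 2^-1 + 2^-1 = 1) ?scale1r//; lra.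
have Tvr p a u v w : Tvec g T p w (a *: u + v) = a *: Tvec g T p w u + Tvec g T p w v.
  by rewrite Ts Tl (Ts p w u) (Ts p w v) scalerN -opprD opprK.
have Tv0 p w : Tvec g T p w 0 = 0.
  by have := Tvr p 1 0 0 w; rewrite scale1r addr0 => /eqP; rewrite -subr_eq subrr scale1r => /eqP.
have TvZ p a u w : Tvec g T p w (a *: u) = a *: Tvec g T p w u.
  by have := Tvr p a u 0 w; rewrite addr0 Tv0 addr0.
have ip0 p w : ip g p 0 w = 0 by rewrite /ip !mul0mx mxE.
have ipD p u v w : ip g p (u + v) w = ip g p u w + ip g p v w.
  by have := ip_linear p 1 u v w; rewrite scale1r mul1r.
have ipZ p a u w : ip g p (a *: u) w = a * ip g p u w.
  by rewrite -[a *: u]addr0 ip_linear ip0 addr0.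
have snabg X Y : smooth_vf A V X -> smooth_vf A V Y ->
    smooth_vf A V (fun q => nabg q (X q) Y).
  by move=> sX sY; have [_ _ _ H] := conng V Y Vo sY; exact: H.
have snabc X Y : smooth_vf A V X -> smooth_vf A V Y ->
    smooth_vf A V (fun q => nabc q (X q) Y).
  move=> sX sY; under eq_fun do rewrite nabcE.
  exact: (smooth_vfD Vo (snabg X Y sX sY)
    (smooth_vfZ Vo (@smooth_fun_cst _ _ _ A V 2^-1) (smooth_Tvec sX sY))).
(* Torsion-freeness writes a bracket as a difference of smooth covariant derivatives. *)
have slie X Y : smooth_vf A V X -> smooth_vf A V Y -> smooth_vf A V (lie A X Y).
  move=> sX sY.
  apply: (smooth_vf_congr Vo _ (smooth_vfB Vo (snabg X Y sX sY) (snabg Y X sY sX))).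
  by move=> q; rewrite inE => Vq; have [-> _] := LC V X Y q Vo sX sY Vq.
have metr p v X Y : V p -> smooth_vf A V X -> smooth_vf A V Y ->
    dr A p v (fun q => ip g q (X q) (Y q)) =
    ip g p (nabc p v X) (Y p) + ip g p (X p) (nabc p v Y).
  move=> Vp sX sY; have [_ H] := LC V X Y p Vo sX sY Vp.
  rewrite [LHS]H !nabcE ipD (ip_sym p (X p)) [X in _ = _ + X]ip_sym ipD !ipZ.
  rewrite !(ip_Tvec T_3form) (form_skew23 T_3form p v (X p)) [ip g p (nabg p v Y) _]ip_sym.
  by move: (ip g p _ _) (ip g p _ _) (T _ _ _ _) => *; ring.
(* Metricity converts parallelism of the 3-form into parallelism of [Tvec], tested against a smooth
   field [Z]; the frame fields are then enough to conclude. *)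
have dr_ip_Tvec p v X Y Z : V p -> smooth_vf A V X -> smooth_vf A V Y -> smooth_vf A V Z ->
    ip g p (nabc p v (fun q => Tvec g T q (X q) (Y q))) (Z p) =
    ip g p (Tvec g T p (nabc p v X) (Y p) + Tvec g T p (X p) (nabc p v Y)) (Z p).
  move=> Vp sX sY sZ; have sT := smooth_Tvec sX sY.
  have E1 := metr p v _ Z Vp sT sZ.
  have E2 : dr A p v (fun q => ip g q (Tvec g T q (X q) (Y q)) (Z q)) =
      dr A p v (fun q => T q (X q) (Y q) (Z q)).
    apply: (@dr_congr _ _ _ A V _ _ p v Vo Vp) => q _; exact: (ip_Tvec T_3form).
  have /eqP := T_parallel v Vo sX sY sZ Vp; rewrite -/nabc -[dd A p v _]/(dr A p v _).
  rewrite -E2 E1 (ip_Tvec T_3form) ipD !(ip_Tvec T_3form).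
  rewrite !subr_eq add0r => /eqP E3.
  by apply: (addIr (T p (X p) (Y p) (nabc p v Z))); rewrite E3 -addrA addrC;
    congr (_ + _); exact: addrC.
split.
- by move=> X Y sX sY; exact: (smooth_vfD Vo sX sY).
- by move=> f X sf sX; exact: (smooth_vfZ Vo sf sX).
- exact: snabc.
- exact: slie.
- exact: smooth_Tvec.
- by move=> X f sX sf; exact: (smooth_dr Vo sX sf).
- by move=> X Y sX sY; have [_ _ H] := g_metric; exact: (H V X Y Vo sX sY).
- by move=> p v f h Vp sf sh; exact: (drD v Vo Vp sf sh).
- by move=> p v f h Vp fh; exact: (@dr_congr _ _ _ A V _ _ p v Vo Vp fh).
- by move=> p X Y f Vp sX sY sf; exact: (dr_lie Vo Vp sX sY sf).
- move=> p X Y Z Vp sX sY sZ.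
  exact: (jacobi Vo Vp sX sY sZ (slie X Y sX sY) (slie Y Z sY sZ) (slie Z X sZ sX)).
- move=> p v X Y Vp sX sY XY; rewrite !nabcE (connection_local v Vp sX sY XY).
  by rewrite (XY p (mem_set Vp)).
- move=> p v X Y Vp sX sY; have [_ /(_ p v Y Vp sY) H _ _] := conng V X Vo sX.
  by rewrite !nabcE H -[X p + Y p]scale1r scalerDr (Tvr p 1) !scale1r scalerDr addrACA.
- move=> p v f X Vp sf sX; have [_ _ /(_ p v f Vp sf) H _] := conng V X Vo sX.
  rewrite !nabcE H -[dd A p v _]/(dr A p v _) TvZ.
  by rewrite scalerDr addrA !scalerA mulrC.
- move=> p a u v X Vp sX; have [/(_ p a u v Vp) H _ _ _] := conng V X Vo sX.
  rewrite !nabcE H Tl scalerDr scalerDr addrACA.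
  by rewrite !scalerA [2^-1 * a]mulrC.
- move=> p X Y Vp sX sY; have [E _] := LC V X Y p Vo sX sY Vp.
  rewrite !nabcE opprD addrACA E; congr (_ + _); exact: half_skew.
- exact: metr.
- move=> p v X Y Vp sX sY.
  rewrite [LHS](orthonormal_expansion _ (fun i j => e_orthonormal i j Vp)).
  rewrite [RHS](orthonormal_expansion _ (fun i j => e_orthonormal i j Vp)).
  apply: eq_bigr => k _; congr (_ *: _).
  exact: (dr_ip_Tvec p v X Y (e k) Vp sX sY (e_smooth k)).
- exact: ip_sym.
- exact: ip_linear.
- exact: Tl.
- exact: Ts.
- by move=> p u v w _; rewrite !(ip_Tvec T_3form) (form_skew23 T_3form).
Qed.

End SkewTorsion.

End Metric.

(** * Differentiation of spinors *)

Section ComplexFields.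
Context {R : realType} {n N : nat} {M : topologicalType} {A : smooth_atlas R n M}.
Implicit Types (V : set M) (p : M) (v : 'rV[R]_n) (c : M -> R)
  (f h : M -> 'cV[R[i]]_N) (X Y : M -> 'rV[R]_n).
Opaque smooth_fun smooth_vf dr dd lie.

Definition smooth_col V f := forall k, csmooth_fun A V (fun q => f q k 0).

Lemma complex_colP (u w : 'cV[R[i]]_N) :
  (forall k, complex.Re (u k 0) = complex.Re (w k 0)) ->
  (forall k, complex.Im (u k 0) = complex.Im (w k 0)) -> u = w.
Proof.
move=> re im; apply/colP => k; apply/eqP; rewrite eq_complex.
by apply/andP; split; apply/eqP.
Qed.

Lemma Re_cdd p v f k :
  complex.Re (cdd A p v f k 0) = dr A p v (fun q => complex.Re (f q k 0)).
Proof. by rewrite mxE. Qed.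

Lemma Im_cdd p v f k :
  complex.Im (cdd A p v f k 0) = dr A p v (fun q => complex.Im (f q k 0)).
Proof. by rewrite mxE. Qed.

Lemma ReD (x y : R[i]) : complex.Re (x + y) = complex.Re x + complex.Re y.
Proof. by case: x y => ? ? [? ?]. Qed.

Lemma ImD (x y : R[i]) : complex.Im (x + y) = complex.Im x + complex.Im y.
Proof. by case: x y => ? ? [? ?]. Qed.

Lemma ReM (x y : R[i]) : complex.Re (x * y) =
  complex.Re x * complex.Re y - complex.Im x * complex.Im y.
Proof. by case: x y => ? ? [? ?]. Qed.

Lemma ImM (x y : R[i]) : complex.Im (x * y) =
  complex.Re x * complex.Im y + complex.Im x * complex.Re y.
Proof. by case: x y => ? ? [? ?]. Qed.

Lemma Re_sum (I : finType) (F : I -> R[i]) :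
  complex.Re (\sum_k F k) = \sum_k complex.Re (F k).
Proof. exact: (big_morph _ ReD). Qed.

Lemma Im_sum (I : finType) (F : I -> R[i]) :
  complex.Im (\sum_k F k) = \sum_k complex.Im (F k).
Proof. exact: (big_morph _ ImD). Qed.

Section OnOpen.
Context {V : set M} (Vo : open V).

Lemma cdd_congr p v f h : V p -> {in V, f =1 h} -> cdd A p v f = cdd A p v h.
Proof.
move=> Vp fh; apply: complex_colP => k; rewrite ?Re_cdd ?Im_cdd.
  by apply: (@dr_congr _ _ _ A V) => // q Vq; rewrite fh.
by apply: (@dr_congr _ _ _ A V) => // q Vq; rewrite fh.
Qed.

Lemma smooth_colZ c f : smooth_fun A V c -> smooth_col V f ->
  smooth_col V (fun q => (c q)%:C *: f q).
Proof.
move=> sc sf k; have [f1 f2] := sf k; split.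
  under eq_fun do rewrite mxE ReM /= mul0r subr0.
  exact: (smooth_funM Vo sc f1).
under eq_fun do rewrite mxE ImM /= mul0r addr0.
exact: (smooth_funM Vo sc f2).
Qed.

Lemma cddZ p v c f : V p -> smooth_fun A V c -> smooth_col V f ->
  cdd A p v (fun q => (c q)%:C *: f q) =
  (dr A p v c)%:C *: f p + (c p)%:C *: cdd A p v f.
Proof.
move=> Vp sc sf; apply: complex_colP => k; have [f1 f2] := sf k.
  rewrite Re_cdd [in RHS]mxE ReD [X in _ = complex.Re X + _]mxE.
  rewrite [X in _ = _ + complex.Re X]mxE !ReM /= !mul0r !subr0 Re_cdd.
  rewrite -(drM v Vo Vp sc f1).
  by congr (dr A p v _); apply/funext => q; rewrite mxE ReM /= mul0r subr0.
rewrite Im_cdd [in RHS]mxE ImD [X in _ = complex.Im X + _]mxE.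
rewrite [X in _ = _ + complex.Im X]mxE !ImM /= !mul0r !addr0 Im_cdd.
rewrite -(drM v Vo Vp sc f2).
by congr (dr A p v _); apply/funext => q; rewrite mxE ImM /= mul0r addr0.
Qed.

Lemma smooth_col_mulmx (B : 'M[R[i]]_N) f : smooth_col V f ->
  smooth_col V (fun q => B *m f q).
Proof.
move=> sf k; split.
  under eq_fun do rewrite mxE Re_sum; apply: (smooth_fun_sum Vo) => l.
  have [f1 f2] := sf l; under eq_fun do rewrite ReM.
  exact: (smooth_funB Vo (smooth_funZ _ Vo f1) (smooth_funZ _ Vo f2)).
under eq_fun do rewrite mxE Im_sum; apply: (smooth_fun_sum Vo) => l.
have [f1 f2] := sf l; under eq_fun do rewrite ImM.
exact: (smooth_funD Vo (smooth_funZ _ Vo f2) (smooth_funZ _ Vo f1)).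
Qed.

Lemma cdd_mulmx p v (B : 'M[R[i]]_N) f : V p -> smooth_col V f ->
  cdd A p v (fun q => B *m f q) = B *m cdd A p v f.
Proof.
move=> Vp sf; apply: complex_colP => k.
  rewrite Re_cdd [in RHS]mxE Re_sum; under eq_fun do rewrite mxE Re_sum.
  rewrite (dr_sum v Vo Vp); last first.
    move=> l; have [f1 f2] := sf l; under eq_fun do rewrite ReM.
    exact: (smooth_funB Vo (smooth_funZ _ Vo f1) (smooth_funZ _ Vo f2)).
  apply: eq_bigr => l _; have [f1 f2] := sf l; under eq_fun do rewrite ReM.
  rewrite (drB v Vo Vp (smooth_funZ _ Vo f1) (smooth_funZ _ Vo f2)).
  by rewrite (drZ v _ Vo Vp f1) (drZ v _ Vo Vp f2) ReM Re_cdd Im_cdd.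
rewrite Im_cdd [in RHS]mxE Im_sum; under eq_fun do rewrite mxE Im_sum.
rewrite (dr_sum v Vo Vp); last first.
  move=> l; have [f1 f2] := sf l; under eq_fun do rewrite ImM.
  exact: (smooth_funD Vo (smooth_funZ _ Vo f2) (smooth_funZ _ Vo f1)).
apply: eq_bigr => l _; have [f1 f2] := sf l; under eq_fun do rewrite ImM.
rewrite (drD v Vo Vp (smooth_funZ _ Vo f2) (smooth_funZ _ Vo f1)).
by rewrite (drZ v _ Vo Vp f2) (drZ v _ Vo Vp f1) ImM Re_cdd Im_cdd.
Qed.

Lemma cdd_lie p X Y f : V p -> smooth_vf A V X -> smooth_vf A V Y -> smooth_col V f ->
  cdd A p (lie A X Y p) f = cdd A p (X p) (fun q => cdd A q (Y q) f) -
                            cdd A p (Y p) (fun q => cdd A q (X q) f).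
Proof.
move=> Vp sX sY sf; rewrite -scaleN1r; apply: complex_colP => k; have [f1 f2] := sf k.
  rewrite [in RHS]mxE [X in complex.Re (_ + X)]mxE ReD ReM /= oppr0 mul0r subr0 mulN1r.
  apply: (etrans (Re_cdd p (lie A X Y p) f k)).
  apply: (etrans _ (esym (congr2 (fun a b => a - b)
    (Re_cdd p (X p) (fun q => cdd A q (Y q) f) k)
    (Re_cdd p (Y p) (fun q => cdd A q (X q) f) k)))).
  apply: (etrans (dr_lie Vo Vp sX sY f1)).
  by congr (dr A p _ _ - dr A p _ _); apply/funext => q; rewrite Re_cdd.
rewrite [in RHS]mxE [X in complex.Im (_ + X)]mxE ImD ImM /= oppr0 mul0r addr0 mulN1r.
apply: (etrans (Im_cdd p (lie A X Y p) f k)).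
  apply: (etrans _ (esym (congr2 (fun a b => a - b)
    (Im_cdd p (X p) (fun q => cdd A q (Y q) f) k)
    (Im_cdd p (Y p) (fun q => cdd A q (X q) f) k)))).
  apply: (etrans (dr_lie Vo Vp sX sY f2)).
by congr (dr A p _ _ - dr A p _ _); apply/funext => q; rewrite Im_cdd.
Qed.

Lemma smooth_col_sum (I : finType) (F : I -> M -> 'cV[R[i]]_N) :
  (forall k, smooth_col V (F k)) -> smooth_col V (fun q => \sum_k F k q).
Proof.
move=> sF k; split.
  under eq_fun do rewrite summxE Re_sum; apply: (smooth_fun_sum Vo) => l.
  by have [] := sF l k.
under eq_fun do rewrite summxE Im_sum; apply: (smooth_fun_sum Vo) => l.
by have [] := sF l k.
Qed.

Lemma cdd_sum p v (I : finType) (F : I -> M -> 'cV[R[i]]_N) : V p ->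
  (forall k, smooth_col V (F k)) ->
  cdd A p v (fun q => \sum_k F k q) = \sum_k cdd A p v (F k).
Proof.
move=> Vp sF; apply: complex_colP => k; rewrite ?Re_cdd ?Im_cdd summxE.
  rewrite Re_sum; under eq_fun do rewrite summxE Re_sum.
  rewrite (dr_sum v Vo Vp); last by move=> l; have [] := sF l k.
  by apply: eq_bigr => l _; rewrite Re_cdd.
rewrite Im_sum; under eq_fun do rewrite summxE Im_sum.
rewrite (dr_sum v Vo Vp); last by move=> l; have [] := sF l k.
by apply: eq_bigr => l _; rewrite Im_cdd.
Qed.

End OnOpen.
End ComplexFields.

(** Here [d], [d'], [z] stand for [X (om Y)], [Y (om X)], [om [X, Y]] acting on the spinor, and [Q]
    for the quadratic part of the structure equation. The factor 4 of [quad_comm] turns the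
    coefficient 1/16 of the products into the common 1/4. *)
Lemma structure_equation_cancel (K : numFieldType) N (Q xy yx z d d' : 'cV[K]_N) :
  xy - yx = 4 *: Q ->
  - 4^-1 *: z = - 4^-1 *: d + 4^-1 ^+ 2 *: yx - (- 4^-1 *: d' + 4^-1 ^+ 2 *: xy) ->
  d - d' - z + Q = 0.
Proof.
have four0 : (4 : K) != 0 by rewrite pnatr_eq0.
move=> comm E; have -> : Q = 4^-1 *: (xy - yx) by rewrite comm scalerA mulVf// scale1r.
apply: (@scalerI K _ (- 4^-1)); first by rewrite oppr_eq0 invr_eq0.
rewrite scaler0 scalerDr scalerBr E.
by apply/colP => i; rewrite !mxE; field.
Qed.

(** * Curvature acting on a parallel spinor *)

Section ParallelSpinorCurvature.
Context {R : realType} {n : nat} {M : topologicalType} {A : smooth_atlas R n M}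
  {g : M -> 'M[R]_n} (g_metric : is_metric A g)
  {gam : 'I_n -> 'M[R[i]]_(spdim n)} (gam_clifford : clifford gam)
  {S : spin_structure A g gam}
  {T : M -> 'rV[R]_n -> 'rV[R]_n -> 'rV[R]_n -> R} (T_3form : is_3form A T)
  {nabg : M -> 'rV[R]_n -> (M -> 'rV[R]_n) -> 'rV[R]_n}
  (nabg_levi_civita : is_levi_civita A g nabg)
  (T_parallel : parallel_3form A (conn g T nabg (1 / 4)) T)
  {phi : triv S -> M -> 'cV[R[i]]_(spdim n)} (phi_spinor : spinor_field phi)
  (phi_parallel : parallel_spinor T nabg (1 / 4) phi)
  {V : set M} (Vo : open V) {a : triv S} (Va : V `<=` tdom a).
Opaque smooth_fun smooth_vf dr dd lie cdd.

Let nabc := conn g T nabg (1 / 4).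
Let f := frame a.

Let f_smooth k : smooth_vf A V (f k).
Proof.
have [sf _] := frame_orthonormal a.
exact: (smooth_vf_sub (tdom_open a) Vo Va (sf k)).
Qed.

Let f_orthonormal p i j : V p -> ip g p (f i p) (f j p) = (i == j)%:R.
Proof. by move=> /Va ap; have [_ H] := frame_orthonormal a; exact: H. Qed.

Let C := skew_torsion_calculus_of_metric g_metric nabg_levi_civita T_3form T_parallel
  Vo f_smooth f_orthonormal.

Let om (X : M -> 'rV[R]_n) k l q : R := ip g q (nabc q (X q) (f k)) (f l q).

Let om_skew X k l q : V q -> om X l k q = - om X k l q.
Proof.
move=> Vq; have := nab_metric C (X q) Vq (f_smooth k) (f_smooth l).
rewrite (_ : dr A q (X q) _ = 0); last first.
  rewrite -(dr_cst A q (X q) (k == l)%:R).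
  apply: (@dr_congr _ _ _ A V _ _ q (X q) Vo Vq) => r; rewrite inE => Vr.
  exact: f_orthonormal.
rewrite (inner_sym C q (f k q)) /om -/nabc => /eqP.
by rewrite eq_sym addr_eq0 => /eqP ->; rewrite opprK.
Qed.

Let qC (w : 'I_n -> 'I_n -> R) : 'M[R[i]]_(spdim n) := quad gam (fun k l => (w k l)%:C).

(** At [s = 1/4] the torsion term of the spinor connection is exactly the lift of the half torsion
    in [nabc], so both merge into [om]. Half of a sum over [k < l] becomes a quarter of the full
    sum. *)
Let parallel_cdd X q : V q ->
  cdd A q (X q) (phi a) = - 4^-1 *: (qC (fun k l => om X k l q) *m phi a q).
Proof.
move=> Vq; have := phi_parallel (X q) (Va Vq); rewrite /spin_conn /spin_lc -/f => /eqP.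
rewrite -addrA addr_eq0 => /eqP ->.
have om_skewC k l : (om X l k q)%:C = - (om X k l q)%:C by rewrite om_skew// rmorphN.
rewrite scaleNr /qC quad_increasing// -scaler_nat -scalemxAl scalerA; congr (- _).
rewrite /cl2 -/f.
rewrite (_ : (1 / 4 : R)%:C = 2^-1 * (2^-1 : R)%:C); last first.
  by rewrite fmorphV rmorph_nat div1r fmorphV rmorph_nat -invfM -natrM.
rewrite (_ : 4^-1 * 2 = 2^-1 :> R[i]); last first.
  by rewrite -[4]/((2 * 2)%:R) natrM invfM -mulrA mulVf ?mulr1// pnatr_eq0.
rewrite -scalerA -scalerDr; congr (_ *: _).
rewrite !mulmx_suml scaler_sumr -big_split; apply: eq_bigr => k _ /=.
rewrite !mulmx_suml scaler_sumr -big_split; apply: eq_bigr => l _ /=.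
rewrite -!scalemxAl scalerA -scalerDl -rmorphM -rmorphD; congr (_%:C *: _).
rewrite /om /nabc /conn [nabg _ _ _ + _]addrC ip_linear (ip_Tvec g_metric T_3form) addrC.
by congr (_ * _ + _); lra.
Qed.

Let phi_smooth : smooth_col (A := A) V (phi a).
Proof.
move=> k; have [sp _] := phi_spinor; have [s1 s2] := sp a k.
by split; [exact: (smooth_fun_sub Va s1)|exact: (smooth_fun_sub Va s2)].
Qed.

Let om_smooth X k l : smooth_vf A V X -> smooth_fun A V (om X k l).
Proof.
by move=> sX; exact: (SF_metric C (SX_nab C sX (f_smooth k)) (f_smooth l)).
Qed.

(** The equation of [parallel_cdd] is differentiated and substituted into itself. The derivative
    along [X] falls on the spinor, so the factor of [X] stands to the right of that of [Y]. *)
Let cdd_twice X Y p : V p -> smooth_vf A V X -> smooth_vf A V Y ->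
  cdd A p (X p) (fun q => cdd A q (Y q) (phi a)) =
  - 4^-1 *: (qC (fun k l => dr A p (X p) (om Y k l)) *m phi a p) +
  4^-1 ^+ 2 *: (qC (fun k l => om Y k l p) *m qC (fun k l => om X k l p) *m phi a p).
Proof.
move=> Vp sX sY; pose B k l : 'M[R[i]]_(spdim n) := - 4^-1 *: (gam k *m gam l).
have E : {in V, (fun q => cdd A q (Y q) (phi a)) =1
    (fun q => \sum_k \sum_l (om Y k l q)%:C *: (B k l *m phi a q))}.
  move=> q; rewrite inE => Vq; rewrite (parallel_cdd Y Vq) /qC /quad mulmx_suml.
  rewrite scaler_sumr; apply: eq_bigr => k _; rewrite mulmx_suml scaler_sumr.
  by apply: eq_bigr => l _; rewrite /B -!scalemxAl !scalerA mulrC.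
have sB k l : smooth_col (A := A) V (fun q => B k l *m phi a q).
  exact: smooth_col_mulmx.
have sOB k l : smooth_col (A := A) V (fun q => (om Y k l q)%:C *: (B k l *m phi a q)).
  exact: (smooth_colZ Vo (om_smooth k l sY) (sB k l)).
rewrite (cdd_congr Vo (X p) Vp E) (cdd_sum Vo (X p) Vp); last first.
  by move=> k; exact: (smooth_col_sum Vo (sOB k)).
have -> : 4^-1 ^+ 2 *: (qC (fun k l => om Y k l p) *m qC (fun k l => om X k l p) *m phi a p) =
    - 4^-1 *: (qC (fun k l => om Y k l p) *m cdd A p (X p) (phi a)).
  rewrite (parallel_cdd X Vp) -scalemxAr scalerA mulrNN -mulmxA expr2 //.
rewrite /qC /quad !mulmx_suml !scaler_sumr -big_split; apply: eq_bigr => k _ /=.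
rewrite (cdd_sum Vo (X p) Vp (sOB k)) !mulmx_suml !scaler_sumr -big_split.
apply: eq_bigr => l _ /=.
rewrite (cddZ Vo (X p) Vp (om_smooth k l sY) (sB k l)) (cdd_mulmx Vo (X p) _ Vp phi_smooth).
by rewrite /B -!scalemxAl !scalerA ![_ * - 4^-1]mulrC.
Qed.

(** The integrability condition of [parallel_cdd]: the bracket acts on [phi] as a commutator, and
    [curvature_frame] identifies the outcome with the curvature 2-form. *)
Lemma spinor_curvature X Y p : V p -> smooth_vf A V X -> smooth_vf A V Y ->
  quad gam (fun k l =>
    (ip g p (curvature (lie := lie A) (nab := nabc) X Y (f k) p) (f l p))%:C) *m phi a p = 0.
Proof.
move=> Vp sX sY; pose Z := lie A X Y; have sZ : smooth_vf A V Z := SX_lie C sX sY.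
have := cdd_lie Vo Vp sX sY phi_smooth.
rewrite (parallel_cdd Z Vp) (cdd_twice Vp sX sY) (cdd_twice Vp sY sX).
have gf u v := ip_orthonormal_sum g_metric u v (fun i j => @f_orthonormal p i j Vp).
have skewC W k l : V p -> (om W l k p)%:C = - (om W k l p)%:C.
  by move=> _; rewrite om_skew// rmorphN.
have comm := quad_comm gam_clifford (fun k l => skewC X k l Vp) (fun k l => skewC Y k l Vp).
have -> : quad gam (fun k l =>
    (ip g p (curvature (lie := lie A) (nab := nabc) X Y (f k) p) (f l p))%:C) =
  qC (fun k l => dr A p (X p) (om Y k l)) - qC (fun k l => dr A p (Y p) (om X k l)) -
  qC (fun k l => om Z k l p) +
  quad gam (fun k l => \sum_m ((om X k m p)%:C * (om Y l m p)%:C -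
                              (om Y k m p)%:C * (om X l m p)%:C)).
  rewrite /qC /quad -!sumrB -big_split; apply: eq_bigr => k _.
  rewrite -!sumrB -big_split; apply: eq_bigr => l _ /=.
  rewrite -!scalerBl -scalerDl; congr (_ *: _).
  rewrite (curvature_frame C k l Vp sX sY f_smooth gf) rmorphD !rmorphB rmorph_sum.
  congr (_ + _); apply: eq_bigr => m _.
  by rewrite rmorphB !rmorphM.
move/(congr1 (mulmx^~ (phi a p))) : comm.
rewrite /= mulmxBl -[_ *+ 4]scaler_nat -scalemxAl => comm E.
rewrite !mulmxDl !mulNmx.
exact: (structure_equation_cancel comm E).
Qed.

End ParallelSpinorCurvature.

(** * Ricci curvature and parallel spinors *)

Section FrameClifford.
Context {R : realType} {n : nat} {M : topologicalType} {A : smooth_atlas R n M}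
  {g : M -> 'M[R]_n} (g_metric : is_metric A g)
  {gam : 'I_n -> 'M[R[i]]_(spdim n)} (gam_clifford : clifford gam)
  {S : spin_structure A g gam} (a : triv S) (p : M) (ap : tdom a p)
  (E : 'I_n -> 'rV[R]_n)
  (E_orthonormal : forall i j, ip g p (E i) (E j) = (i == j)%:R).
Implicit Types (u v : 'rV[R]_n).

Let f k := frame a k p.

Let f_orthonormal i j : ip g p (f i) (f j) = (i == j)%:R.
Proof. by have [_ H] := frame_orthonormal a; exact: H. Qed.

Lemma ip_sum (I : finType) (c : I -> R) (F : I -> 'rV[R]_n) w :
  ip g p (\sum_k c k *: F k) w = \sum_k c k * ip g p (F k) w.
Proof.
rewrite /ip !mulmx_suml summxE; apply: eq_bigr => k _.
by rewrite -!scalemxAl mxE.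
Qed.

Lemma cl1_vec v : cl1 a p v = vec gam (fun i => (ip g p v (f i))%:C).
Proof. by apply: eq_bigr => i _; rewrite mxE. Qed.

Lemma cl1_sum (I : finType) (c : I -> R) (F : I -> 'rV[R]_n) :
  cl1 a p (\sum_k c k *: F k) = \sum_k (c k)%:C *: cl1 a p (F k).
Proof.
rewrite cl1_vec; under [RHS]eq_bigr do rewrite cl1_vec scaler_sumr.
rewrite exchange_big; apply: eq_bigr => i _ /=.
rewrite ip_sum rmorph_sum scaler_suml; apply: eq_bigr => k _.
by rewrite scalerA rmorphM.
Qed.

Lemma cl1_frame v : cl1 a p v = vec (fun b => cl1 a p (E b)) (fun b => (ip g p v (E b))%:C).
Proof. by rewrite {1}(orthonormal_expansion v E_orthonormal) cl1_sum. Qed.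

(** Clifford multiplication by any orthonormal frame satisfies the relations of [gam], so the
    algebraic lemmas apply directly in the frame [E]. *)
Lemma cl1_clifford i j :
  cl1 a p (E i) *m cl1 a p (E j) + cl1 a p (E j) *m cl1 a p (E i) =
  (- ((i == j)%:R *+ 2))%:M.
Proof.
have d : \sum_k (ip g p (E i) (f k))%:C * (ip g p (E j) (f k))%:C = (i == j)%:R.
  rewrite -(rmorph_nat (real_complex R)) -E_orthonormal.
  rewrite (ip_orthonormal_sum g_metric _ _ f_orthonormal) rmorph_sum.
  by apply: eq_bigr => k _; rewrite rmorphM.
rewrite !cl1_vec /vec.
have -> : (- ((i == j)%:R *+ 2))%:M = \sum_k \sum_l
   ((ip g p (E i) (f k))%:C * (ip g p (E j) (f l))%:C) *: (- ((k == l)%:R *+ 2))%:M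
   :> 'M[R[i]]_(spdim n).
  under eq_bigr => k _.
    rewrite (bigD1 k) //= big1 ?addr0; last first.
      by move=> l lk; rewrite eq_sym (negPf lk) mul0rn oppr0 raddf0 scaler0.
    rewrite eqxx scale_scalar_mx.
    over.
  rewrite -raddf_sum -mulr_suml d; congr (_%:M).
  by rewrite mulrN mulrnAr mulr1.
rewrite !mulmx_suml.
under eq_bigr do rewrite mulmx_sumr.
under [X in _ + X]eq_bigr do rewrite mulmx_sumr.
rewrite [X in _ + X]exchange_big -big_split; apply: eq_bigr => k _ /=.
rewrite -big_split; apply: eq_bigr => l _ /=.
rewrite -gam_clifford scalerDr -!scalemxAl -!scalemxAr !scalerA.
by congr (_ + _ *: _); rewrite mulrC.
Qed.

(** [cl2] is defined through the spin frame. Doubling makes it a full sum, which can be rewritten in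
    the frame [E]; the factor 6 in [cl3_frame] has the same purpose. *)
Lemma cl2_frame (w : 'rV[R]_n -> 'rV[R]_n -> R) :
  (forall u v, w v u = - w u v) ->
  (forall (c : 'I_n -> R) F v, w (\sum_k c k *: F k) v = \sum_k c k * w (F k) v) ->
  cl2 a p w *+ 2 = quad (fun b => cl1 a p (E b)) (fun b c => (w (E b) (E c))%:C).
Proof.
move=> wC wl.
have wl2 (c : 'I_n -> R) F v : w v (\sum_k c k *: F k) = \sum_k c k * w v (F k).
  by rewrite wC wl -sumrN; apply: eq_bigr => k _; rewrite (wC (F k) v) mulrN.
have -> : cl2 a p w *+ 2 = quad gam (fun k l => (w (f k) (f l))%:C).
  by rewrite (quad_increasing gam_clifford)// => k l; rewrite wC rmorphN.
symmetry; apply: (@quad_frame_change _ _ _ gam _ (fun b k => (ip g p (E b) (f k))%:C)).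
  by move=> b; exact: cl1_vec.
move=> k l; rewrite {1}(orthonormal_expansion (f k) E_orthonormal) wl rmorph_sum.
apply: eq_bigr => b _.
rewrite {1}(orthonormal_expansion (f l) E_orthonormal) wl2 mulr_sumr rmorph_sum.
apply: eq_bigr => c _; rewrite !rmorphM (ip_sym g_metric p (f k)) (ip_sym g_metric p (f l)).
ring.
Qed.

Lemma cl3_frame (w : 'rV[R]_n -> 'rV[R]_n -> 'rV[R]_n -> R) :
  (forall u v z, w v u z = - w u v z) -> (forall u v z, w u z v = - w u v z) ->
  (forall (c : 'I_n -> R) F v z, w (\sum_k c k *: F k) v z = \sum_k c k * w (F k) v z) ->
  cl3 a p w *+ 6 = cubic (fun b => cl1 a p (E b)) (fun b c d => (w (E b) (E c) (E d))%:C).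
Proof.
move=> w12 w23 wl.
have wl2 (c : 'I_n -> R) F v z : w v (\sum_k c k *: F k) z = \sum_k c k * w v (F k) z.
  by rewrite w12 wl -sumrN; apply: eq_bigr => k _; rewrite (w12 (F k) v) mulrN.
have wl3 (c : 'I_n -> R) F v z : w v z (\sum_k c k *: F k) = \sum_k c k * w v z (F k).
  by rewrite w23 wl2 -sumrN; apply: eq_bigr => k _; rewrite (w23 v (F k) z) mulrN.
have -> : cl3 a p w *+ 6 = cubic gam (fun i j k => (w (f i) (f j) (f k))%:C).
  rewrite (cubic_increasing gam_clifford)// => i j k; rewrite -rmorphN; congr (_%:C).
    exact: w12.
  exact: w23.
symmetry; apply: (@cubic_frame_change _ _ _ gam _ (fun b k => (ip g p (E b) (f k))%:C)).
  by move=> b; exact: cl1_vec.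
move=> i j k; rewrite {1}(orthonormal_expansion (f i) E_orthonormal) wl rmorph_sum.
apply: eq_bigr => b _.
rewrite {1}(orthonormal_expansion (f j) E_orthonormal) wl2 mulr_sumr rmorph_sum.
apply: eq_bigr => c _.
rewrite {1}(orthonormal_expansion (f k) E_orthonormal) wl3 !mulr_sumr rmorph_sum.
apply: eq_bigr => d _; rewrite !rmorphM (ip_sym g_metric p (f i)).
rewrite (ip_sym g_metric p (f j)) (ip_sym g_metric p (f k)); ring.
Qed.

End FrameClifford.

Section ParallelSpinorRicci.
Context {R : realType} {n : nat} {M : topologicalType} {A : smooth_atlas R n M}
  {g : M -> 'M[R]_n} (g_metric : is_metric A g)
  {gam : 'I_n -> 'M[R[i]]_(spdim n)} (gam_clifford : clifford gam)
  {S : spin_structure A g gam}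
  {T : M -> 'rV[R]_n -> 'rV[R]_n -> 'rV[R]_n -> R} (T_3form : is_3form A T)
  {nabg : M -> 'rV[R]_n -> (M -> 'rV[R]_n) -> 'rV[R]_n}
  (nabg_levi_civita : is_levi_civita A g nabg)
  (T_parallel : parallel_3form A (conn g T nabg (1 / 4)) T)
  {phi : triv S -> M -> 'cV[R[i]]_(spdim n)} (phi_spinor : spinor_field phi)
  (phi_parallel : parallel_spinor T nabg (1 / 4) phi)
  {V : set M} (Vo : open V) {a : triv S} (Va : V `<=` tdom a)
  {e : 'I_n -> M -> 'rV[R]_n} (e_smooth : forall i, smooth_vf A V (e i))
  (e_orthonormal : forall p i j, V p -> ip g p (e i p) (e j p) = (i == j)%:R).
Opaque smooth_fun smooth_vf dr dd lie cdd.

Let nabc := conn g T nabg (1 / 4).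

Let C := skew_torsion_calculus_of_metric g_metric nabg_levi_civita T_3form T_parallel
  Vo e_smooth e_orthonormal.

Let f k := frame a k.

Let f_smooth k : smooth_vf A V (f k).
Proof.
have [sf _] := frame_orthonormal a.
exact: (smooth_vf_sub (tdom_open a) Vo Va (sf k)).
Qed.

(** Once the contracted index of [T] is rotated to the first place, Parseval in the frame [e] turns
    the inner products into the sums of the wedge squares. *)
Lemma sigmaTE p u v w z : V p ->
  sigmaT e T p u v w z = torsion4 (g := ip g) (Tv := Tvec g T) p u v w z.
Proof.
move=> Vp; have eo i j := @e_orthonormal p i j Vp.
have rot u1 u2 x : T p u1 u2 x = T p x u1 u2.
  by rewrite (form_skew23 T_3form p u1 x u2) (form_skew12 T_3form p x u1 u2) opprK.
have TT u1 u2 u3 u4 : ip g p (Tvec g T p u1 u2) (Tvec g T p u3 u4) =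
    \sum_i T p (e i p) u1 u2 * T p (e i p) u3 u4.
  rewrite (ip_orthonormal_sum g_metric _ _ eo); apply: eq_bigr => i _.
  rewrite !(ip_Tvec g_metric T_3form).
  by rewrite (rot u1 u2) (rot u3 u4).
rewrite /sigmaT /torsion4 !TT -!big_split mulr_sumr; apply: eq_bigr => i _.
rewrite /wedge22 (form_skew23 T_3form p (e i p) u w) /=.
by field.
Qed.

Lemma sigmaT_skew12 p x u v z : sigmaT e T p x v u z = - sigmaT e T p x u v z.
Proof.
rewrite /sigmaT -mulrN -sumrN; congr (_ * _); apply: eq_bigr => i _.
by rewrite /wedge22 (form_skew23 T_3form p (e i p) u v); ring.
Qed.

Lemma sigmaT_skew23 p x u v z : sigmaT e T p x u z v = - sigmaT e T p x u v z.
Proof.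
rewrite /sigmaT -mulrN -sumrN; congr (_ * _); apply: eq_bigr => i _.
by rewrite /wedge22 (form_skew23 T_3form p (e i p) v z); ring.
Qed.

Lemma sigmaT_linear p x b u u' v z :
  sigmaT e T p x (b *: u + u') v z = b * sigmaT e T p x u v z + sigmaT e T p x u' v z.
Proof.
rewrite /sigmaT !mulr_sumr -big_split; apply: eq_bigr => i _ /=.
rewrite /wedge22 !(form_linear2 T_3form) !(form_linear3 T_3form); ring.
Qed.

Lemma ricci_parallel_spinor X p : V p -> smooth_vf A V X ->
  cl1 a p (ric A nabc e X p) *m phi a p = cl3 a p (sigmaT e T p (X p)) *m phi a p.
Proof.
move=> Vp sX; have ap := Va Vp; have eo i j := @e_orthonormal p i j Vp.
pose gam' b := cl1 a p (e b p).
have gam'_clifford := cl1_clifford g_metric gam_clifford ap eo.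
pose r j k l : R := ip g p (curvature (lie := lie A) (nab := nabc) X (e j) (e k) p) (e l p).
(* [spinor_curvature] takes the last pair of indices in the spin frame; tensoriality moves that pair
   to the frame [e]. *)
have r0 j : quad gam' (fun k l => (r j k l)%:C) *m phi a p = 0.
  rewrite -[RHS](spinor_curvature g_metric gam_clifford T_3form nabg_levi_civita
    T_parallel phi_spinor phi_parallel Vo Va Vp sX (e_smooth j)).
  congr (_ *m _).
  apply: (@quad_frame_change _ _ _ gam _ (fun b k => (ip g p (e b p) (f k p))%:C)).
    by move=> b; exact: cl1_vec.
  move=> k l; pose h b q := ip g q (f k q) (e b q).
  have sh b : smooth_fun A V (h b) by exact: (SF_metric C (f_smooth k) (e_smooth b)).
  have s0 : smooth_vf A V (fun=> 0) := smooth_vf0 Vo.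
  have sk : smooth_vf A V (fun q => \sum_b h b q *: e b q).
    by apply: (smooth_vf_sum Vo) => b; exact: (smooth_vfZ Vo (sh b) (e_smooth b)).
  have fk : {in V, f k =1 (fun q => \sum_b h b q *: e b q)}.
    move=> q; rewrite inE => Vq.
    exact: (orthonormal_expansion _ (fun i j => @e_orthonormal q i j Vq)).
  rewrite (curvature_eq3 C Vp sX (e_smooth j) (f_smooth k) sk fk).
  rewrite (curvature_lincomb3 C Vp sX (e_smooth j) sh e_smooth s0) ip_sum rmorph_sum.
  apply: eq_bigr => b _; rewrite (ip_orthonormal_sum g_metric _ _ eo) mulr_sumr rmorph_sum.
  apply: eq_bigr => c _; rewrite /h !rmorphM (ip_sym g_metric p (f k p)).
  rewrite (ip_sym g_metric p (f l p)) /r; ring.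
have := ricci_contraction gam'_clifford _ _ r0.
move=> /(_ (fun j k l => (sigmaT e T p (X p) (e j p) (e k p) (e l p))%:C)) H.
have {}H := H _ _.
apply: (@scalerI _ _ 6); first by rewrite pnatr_eq0.
rewrite [RHS]scalemxAl [6 *: cl3 _ _ _]scaler_nat
  (cl3_frame g_metric gam_clifford a eo); last 3 first.
- exact: sigmaT_skew12.
- exact: sigmaT_skew23.
- move=> c F v z; apply: (@linear_form_sum R n (fun u => sigmaT e T p (X p) u v z)).
  by move=> b u u'; exact: sigmaT_linear.
rewrite -H.
- congr (_ *: (_ *m _)); rewrite (cl1_frame a eo); apply: eq_bigr => l _.
  congr (_ *: _); rewrite -rmorph_sum; congr (_%:C).
  (* Unit coefficients give the plain sum [ric] the shape required by [ip_sum]. *)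
  rewrite /ric -[in LHS](eq_bigr _ (fun i _ => scale1r _)) ip_sum.
  by apply: eq_bigr => j _; rewrite mul1r.
- by move=> j k l; rewrite /r (curvature_skew C Vp sX (e_smooth j) (e_smooth l) (e_smooth k))
    rmorphN.
move=> j k l; rewrite -!rmorphD; congr (_%:C); rewrite sigmaTE// /r.
exact: (curvature_cyclic C Vp sX (e_smooth j) (e_smooth k) (e_smooth l)).
Qed.

Lemma torsion_eigen_quad (mu : R[i]) p v : V p ->
  cl2 a p (T p v) *m phi a p = mu *: (cl1 a p v *m phi a p) ->
  quad (fun b => cl1 a p (e b p)) (fun b c => (T p v (e b p) (e c p))%:C) *m phi a p =
  (2 * mu) *: (cl1 a p v *m phi a p).
Proof.
move=> Vp H; have eo i j := @e_orthonormal p i j Vp.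
rewrite -(cl2_frame g_metric gam_clifford a eo).
- by rewrite -scaler_nat -scalemxAl H scalerA.
- by move=> x y; exact: (form_skew23 T_3form).
- move=> c F y; apply: (@linear_form_sum R n (fun x => T p v x y)).
  by move=> b x x'; exact: (form_linear2 T_3form).
Qed.

(** The constant is the [2 (n - 3)] of [cubic_four_form_eigen] divided by the 6 that normalises
    [cubic]. *)
Lemma sigmaT_eigen (mu : R[i]) p v : V p ->
  (forall u, cl2 a p (T p u) *m phi a p = mu *: (cl1 a p u *m phi a p)) ->
  cl3 a p (sigmaT e T p v) *m phi a p =
  ((n%:R - 3) / 3 * mu ^+ 2) *: (cl1 a p v *m phi a p).
Proof.
move=> Vp H; have ap := Va Vp; have eo i j := @e_orthonormal p i j Vp.
pose t i j k : R[i] := (T p (e i p) (e j p) (e k p))%:C.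
have t12 i j k : t j i k = - t i j k by rewrite /t (form_skew12 T_3form) rmorphN.
have t23 i j k : t i k j = - t i j k by rewrite /t (form_skew23 T_3form) rmorphN.
have gam'_clifford := cl1_clifford g_metric gam_clifford ap eo.
have Q y := torsion_eigen_quad Vp (H (e y p)).
apply: (@scalerI _ _ 6); first by rewrite pnatr_eq0.
rewrite [LHS]scalemxAl [6 *: cl3 _ _ _]scaler_nat
  (cl3_frame g_metric gam_clifford a eo); last 3 first.
- by move=> *; exact: sigmaT_skew12.
- by move=> *; exact: sigmaT_skew23.
- move=> c F x z; apply: (@linear_form_sum R n (fun u => sigmaT e T p v u x z)).
  by move=> b u u'; exact: sigmaT_linear.
(* [four_form] takes frame indices only, so [v] is first expanded in the frame. *)
pose x k : R[i] := (ip g p v (e k p))%:C.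
have -> : cubic (fun b => cl1 a p (e b p))
    (fun b c d => (sigmaT e T p v (e b p) (e c p) (e d p))%:C) =
    \sum_k x k *: cubic (fun b => cl1 a p (e b p)) (four_form t k).
  rewrite /cubic; under [RHS]eq_bigr do rewrite scaler_sumr.
  rewrite [RHS]exchange_big; apply: eq_bigr => b _ /=.
  under [RHS]eq_bigr do rewrite scaler_sumr.
  rewrite [RHS]exchange_big; apply: eq_bigr => c _ /=.
  under [RHS]eq_bigr do rewrite scaler_sumr.
  rewrite [RHS]exchange_big; apply: eq_bigr => d _ /=.
  under [RHS]eq_bigr do rewrite scalerA.
  rewrite -scaler_suml; congr (_ *: _).
  rewrite /four_form; under [RHS]eq_bigr do rewrite mulr_sumr.
  rewrite [RHS]exchange_big /sigmaT mulr_sumr rmorph_sum; apply: eq_bigr => i _ /=.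
  have Te y : T p (e i p) v y = \sum_k ip g p v (e k p) * T p (e i p) (e k p) y.
    rewrite {1}(orthonormal_expansion v eo).
    apply: (@linear_form_sum R n (fun u => T p (e i p) u y)).
    by move=> *; exact: (form_linear2 T_3form).
  transitivity ((T p (e i p) v (e b p) * T p (e i p) (e c p) (e d p) -
      T p (e i p) v (e c p) * T p (e i p) (e b p) (e d p) +
      T p (e i p) v (e d p) * T p (e i p) (e b p) (e c p))%:C).
    by congr (_%:C); rewrite /wedge22; field.
  rewrite !Te !mulr_suml -sumrB -big_split rmorph_sum; apply: eq_bigr => k _.
  by rewrite /x /t /= !(rmorphD, rmorphN, rmorphM); ring.
rewrite mulmx_suml.
under eq_bigr do rewrite -scalemxAl (cubic_four_form_eigen gam'_clifford _ t12 t23 Q)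
  scalerA mulrC -scalerA.
rewrite -scaler_sumr (cl1_frame a eo v) /vec mulmx_suml scalerA.
under [in RHS]eq_bigr do rewrite -scalemxAl.
by congr (_ *: _); field.
Qed.

(** Replace [(e_i _| T) phi] by [mu e_i phi]. The sum of the products [T(v, e_i) e_i] is minus the
    full sum of the 2-form [v _| T], which acts on [phi] as [2 mu v]. *)
Lemma torsion_square_eigen (mu : R[i]) p v : V p ->
  (forall u, cl2 a p (T p u) *m phi a p = mu *: (cl1 a p u *m phi a p)) ->
  \sum_(i < n) cl1 a p (Tvec g T p v (e i p)) *m (cl2 a p (T p (e i p)) *m phi a p) =
  - (2 * mu ^+ 2) *: (cl1 a p v *m phi a p).
Proof.
move=> Vp H; have eo i j := @e_orthonormal p i j Vp.
have := torsion_eigen_quad Vp (H v); rewrite /quad exchange_big mulmx_suml => E.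
have -> : - (2 * mu ^+ 2) = - mu * (2 * mu) by ring.
rewrite -scalerA -E scaler_sumr; apply: eq_bigr => i _.
rewrite H -scalemxAr (cl1_frame a eo (Tvec g T p v (e i p))) /vec.
move: (cl1 a p (e i p)) => G; rewrite !mulmx_suml !scaler_sumr; apply: eq_bigr => l _.
rewrite (ip_Tvec g_metric T_3form) (form_skew23 T_3form p v (e l p)) rmorphN.
by rewrite -!scalemxAl !scalerA mulmxA; congr (_ *: _); ring.
Qed.

End ParallelSpinorRicci.

(** * The Ricci identity where both frames are defined *)

Unset Implicit Arguments.
Set Strict Implicit.

Theorem corollary6p3 (R : realType) (n : nat) (n_gt3 : (3 < n)%N)
  (M : topologicalType) (A : smooth_atlas R n M)
  (M_hausdorff : hausdorff_space M) (M_second_countable : @second_countable M)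
  (M_compact : compact [set: M]) (M_connected : connected [set: M])
  (g : M -> 'M[R]_n) (g_metric : is_metric A g)
  (gam : 'I_n -> 'M[R[i]]_(spdim n)) (gam_clifford : clifford gam)
  (S : spin_structure A g gam)
  (T : M -> 'rV[R]_n -> 'rV[R]_n -> 'rV[R]_n -> R) (T_3form : is_3form A T)
  (T_nontrivial : exists p u v w, T p u v w <> 0)
  (nabg : M -> 'rV[R]_n -> (M -> 'rV[R]_n) -> 'rV[R]_n)
  (nabg_levi_civita : is_levi_civita A g nabg)
  (T_parallel : parallel_3form A (conn g T nabg (1 / 4)) T)
  (s : R) (s_def : s = (n%:R - 1) / (4 * (n%:R - 3)))
  (gamma : R[i]) (gamma_neq0 : gamma <> 0) (gamma_spec : Spec S T gamma)
  (zeta : R[i]) (zeta_def : zeta = 3 * gamma * (1 - 4 * s)%:C / (4 * n%:R))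
  (phi0 : triv S -> M -> 'cV[R[i]]_(spdim n))
  (phi0_killing : killing T nabg s zeta phi0)
  (phi0_parallel : parallel_spinor T nabg (1 / 4) phi0)
  (lambda : R) (lambda_def : lambda = 1 / (2 * (n%:R - 3))) :
  forall (X : M -> 'rV[R]_n), smooth_vf A [set: M] X ->
  forall (W : set M) (e : 'I_n -> M -> 'rV[R]_n),
    open W -> orthonormal_frame A g W e ->
  forall (a : triv S) (p : M), W p -> tdom a p ->
    cl1 a p (ric A (conn g T nabg (1 / 4)) e X p) *m phi0 a p =
    - (16 * s%:C * zeta) *: (cl2 a p (T p (X p)) *m phi0 a p)
    + (4 * (n%:R - 1) * zeta ^+ 2) *: (cl1 a p (X p) *m phi0 a p)
    + (1 - 12 * lambda ^+ 2)%:C *: (cl3 a p (sigmaT e T p (X p)) *m phi0 a p)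
    - (2 * (2 * lambda ^+ 2 + lambda))%:C *:
        (\sum_(i < n) cl1 a p (Tvec g T p (X p) (e i p)) *m
                        (cl2 a p (T p (e i p)) *m phi0 a p)).
Proof.
move=> X sX W e Wo [e_smooth e_on] a p Wp ap.
(* On [V] both the given frame [e] and the spin frame are available. *)
pose V := W `&` tdom a; have Vo : open V by apply: openI => //; exact: tdom_open.
have Vp : V p by split.
have Va : V `<=` tdom a by move=> q [].
have VW : V `<=` W by move=> q [].
have sXV : smooth_vf A V X by apply: (smooth_vf_sub openT Vo _ sX).
have sW : forall i, smooth_vf A V (e i).
  by move=> i; exact: (smooth_vf_sub Wo Vo VW (e_smooth i)).
have eo q i j : V q -> ip g q (e i q) (e j q) = (i == j)%:R.
  by move=> /VW; exact: e_on.
have [phi_spinor phi_kill] := phi0_killing.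
have n3 : (n%:R - 3 : R) != 0.
  by rewrite subr_eq0 eqr_nat; move: n_gt3; case: ltngtP.
have lambda0 : lambda%:C != 0 :> R[i].
  rewrite fmorph_eq0 lambda_def div1r invr_eq0 mulf_neq0//.
(* As [(n - 1) - (n - 3) = 2], the constant [lambda] is the gap between the parameters of the two
   spinor connections. *)
have s14 : s - 1 / 4 = lambda by rewrite s_def lambda_def; field.
pose mu := zeta / lambda%:C.
have H u : cl2 a p (T p u) *m phi0 a p = mu *: (cl1 a p u *m phi0 a p).
  have := phi_kill a p u ap; rewrite /spin_conn.
  have := phi0_parallel a p u ap; rewrite /spin_conn => /eqP.
  rewrite addr_eq0 => /eqP ->; rewrite addrC -scalerBl -rmorphB s14 => E.
  by rewrite /mu mulrC -scalerA -E scalerA mulVf// scale1r.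
rewrite (ricci_parallel_spinor g_metric gam_clifford T_3form nabg_levi_civita T_parallel
  phi_spinor phi0_parallel Vo Va sW eo Vp sXV).
rewrite (torsion_square_eigen g_metric gam_clifford T_3form eo (X p) Vp H) H.
rewrite (sigmaT_eigen g_metric gam_clifford T_3form Va eo (X p) Vp H).
move: (cl1 a p (X p) *m phi0 a p) => u.
have -> : zeta = mu * lambda%:C by rewrite /mu divfK.
have n3C : (n%:R - 3 : R[i]) != 0.
  by rewrite subr_eq0 eqr_nat; move: n_gt3; case: ltngtP.
have lC : lambda%:C = 1 / (2 * (n%:R - 3)) :> R[i].
  by rewrite lambda_def !(fmorph_div, rmorphM, rmorphB, rmorph_nat, rmorph1).
have sC : s%:C = (n%:R - 1) / (4 * (n%:R - 3)) :> R[i].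
  by rewrite s_def !(fmorph_div, rmorphM, rmorphB, rmorph_nat, rmorph1).
have -> : (1 - 12 * lambda ^+ 2)%:C = 1 - 12 * lambda%:C ^+ 2 :> R[i].
  by rewrite rmorphB rmorph1 rmorphM rmorphXn rmorph_nat.
have -> : (2 * (2 * lambda ^+ 2 + lambda))%:C =
    2 * (2 * lambda%:C ^+ 2 + lambda%:C) :> R[i].
  by rewrite mulrDr mulrA rmorphD !rmorphM !rmorph_nat; ring.
(* Put [m = n - 3] and count in units of [mu ^+ 2]. The 1 in [1 - 12 lambda ^+ 2] reproduces the
   left side; the other contributions are - 2 (m + 2) / m^2, (m + 2) / m^2, - 1 / m and 2 / m^2 + 2
   / m, with sum 0. *)
rewrite lC sC; clearbody mu.
by apply/colP => i; rewrite !mxE; field.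
Qed.
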